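(* Let $K$ be a number field and let $f:\mathbb{A}^N\to\mathbb{A}^N$ be a polynomial map (affine morphism) defined over $K$ whose extension $f:\mathbb{P}^N\dashrightarrow\mathbb{P}^N$ is dominant and satisfies $\delta_f>1$. Suppose there exist an integer $m\ge1$ and a point $Q_0\in\mathbb{P}^N(K)$ lying on the hyperplane at infinity $\mathbb{P}^N\setminus\mathbb{A}^N$ such that $f^m$ is defined at $Q_0$ and $f^m(Q_0)=Q_0$. Then there exist a prime $\mathfrak{p}$ of $K$ and a $\mathfrak{p}$-adic neighborhood $U\subseteq\mathbb{P}^N(K_{\mathfrak{p}})$ of $Q_0$ such that $\underline{\hat h}^\circ_f(P)>0$ for all $P\in U\cap\mathbb{A}^N(K)$.
   Context: $\delta_f=\lim_{n\to\infty}\rho((f^n)^* )^{1/n}$, with $(f^n)^*$ acting on $\mathrm{NS}(\mathbb{P}^N)_{\mathbb{R}}$ and $\rho$ the spectral radius. For $P\in\mathbb{A}^N(K)$, $\underline{\hat h}^\circ_f(P)=\liminf_{n\to\infty}h(f^n(P))/\delta_f^n\in\mathbb{R}\cup\{\infty\}$, where $h$ is the standard absolute logarithmic Weil height on $\mathbb{P}^N$. *)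

(* Defs.v *)
From HB Require Import structures.
From mathcomp Require Import all_boot all_order all_algebra all_field.
From mathcomp Require Import all_classical all_reals all_analysis.
From mathcomp Require Import finmap complex freeg.
(* Its notations clash with those of mathcomp-analysis. *)
From mathcomp Require Import (canonicals, coercions, hints) mpoly.

Set Implicit Arguments.
Unset Strict Implicit.
Unset Printing Implicit Defensive.

Import Order.TTheory GRing.Theory Num.Theory.
Import numFieldNormedType.Exports.
Local Open Scope classical_set_scope.
Local Open Scope ring_scope.

(* Normalised discrete valuations, written additively.  The value at 0, which
   should be +oo, is pinned to 0 so that distinct functions are distinct
   valuations; every use below singles out 0 explicitly. *)
Record discrete_valuation (F : fieldType) (v : F -> int) : Prop := {
  dval0 : v 0 = 0;
  dvalM : forall x y, x != 0 -> y != 0 -> v (x * y) = v x + v y;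
  dvalD : forall x y, x != 0 -> y != 0 -> x + y != 0 ->
            Num.min (v x) (v y) <= v (x + y);
  dval_surj : exists2 x, x != 0 & v x = 1 }.

(* v x >= k, with v 0 = +oo *)
Definition vge (F : fieldType) (v : F -> int) (k : int) (x : F) : bool :=
  (x == 0) || (k <= v x).

Definition vcauchy (F : fieldType) (v : F -> int) (u : nat -> F) : Prop :=
  forall k : int, exists n0 : nat, forall m n : nat,
    (n0 <= m)%N -> (n0 <= n)%N -> vge v k (u m - u n).

Definition vcvg (F : fieldType) (v : F -> int) (u : nat -> F) (y : F) : Prop :=
  forall k : int, exists n0 : nat, forall n : nat,
    (n0 <= n)%N -> vge v k (u n - y).

Record completion (F : fieldType) (v : F -> int) := Completion {
  compl_field :> fieldType;
  compl_val : compl_field -> int;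
  compl_emb : {rmorphism F -> compl_field};
  compl_valP : discrete_valuation compl_val;
  compl_embP : forall x, compl_val (compl_emb x) = v x;
  compl_dense : forall (y : compl_field) (k : int),
                  exists x, vge compl_val k (y - compl_emb x);
  compl_complete : forall u, vcauchy compl_val u ->
                     exists y, vcvg compl_val u y }.

Section DiscreteValuation.
Variables (F : fieldType) (v : F -> int).
Hypothesis vP : discrete_valuation v.

Lemma dval1 : v 1 = 0.
Proof.
have /eqP := dvalM vP (oner_neq0 F) (oner_neq0 F).
by rewrite mulr1 -subr_eq0 opprD addNKr oppr_eq0 => /eqP.
Qed.

Lemma dvalN x : v (- x) = v x.
Proof.
have [->|x0] := eqVneq x 0; first by rewrite oppr0.
have N1 : (-1 : F) != 0 by rewrite oppr_eq0 oner_eq0.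
have e : v (-1) = 0.
  have := dvalM vP N1 N1; rewrite mulrNN mulr1 dval1 => /esym/eqP.
  by rewrite -mulr2n mulrn_eq0 /= => /eqP.
by rewrite -mulN1r (dvalM vP) // e add0r.
Qed.

Lemma vge0 k : vge v k 0. Proof. by rewrite /vge eqxx. Qed.

Lemma vgeN k x : vge v k (- x) = vge v k x.
Proof. by rewrite /vge oppr_eq0 dvalN. Qed.

Lemma vge_le k l x : l <= k -> vge v k x -> vge v l x.
Proof. by rewrite /vge => lk /orP[->//|h]; rewrite (le_trans lk h) orbT. Qed.

Lemma vgeD k x y : vge v k x -> vge v k y -> vge v k (x + y).
Proof.
have [->|x0] := eqVneq x 0; first by rewrite add0r.
have [->|y0] := eqVneq y 0; first by rewrite addr0.
rewrite /vge (negPf x0) (negPf y0) /= => kx ky.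
have [//|s0] := eqVneq (x + y) 0.
by rewrite (le_trans _ (dvalD vP x0 y0 s0))// le_min kx ky.
Qed.

Lemma vgeB k x y : vge v k x -> vge v k y -> vge v k (x - y).
Proof. by move=> ? ?; rewrite vgeD ?vgeN. Qed.

Lemma vgeM k l x y : vge v k x -> vge v l y -> vge v (k + l) (x * y).
Proof.
have [->|x0] := eqVneq x 0; first by rewrite mul0r => *; exact: vge0.
have [->|y0] := eqVneq y 0; first by rewrite mulr0 => *; exact: vge0.
rewrite /vge (negPf x0) (negPf y0) /= => kx ky.
by rewrite (dvalM vP) // lerD // orbT.
Qed.

Lemma vge_eq k x y : ~~ vge v k y -> vge v k (x - y) -> x != 0 /\ v x = v y.
Proof.
move=> nky kxy.
have y0 : y != 0 by apply: contraNneq nky => ->; exact: vge0.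
have vyk : v y < k by move: nky; rewrite /vge negb_or -ltNge => /andP[].
have x0 : x != 0.
  apply: contraNneq nky => x0; move: kxy.
  by rewrite x0 add0r vgeN.
split=> //; apply/eqP; rewrite eq_le; apply/andP; split; last first.
  have : vge v (v y) (x - y + y).
    by apply: vgeD; [apply: vge_le kxy; exact: ltW | rewrite /vge lexx orbT].
  by rewrite subrK /vge (negPf x0).
rewrite leNgt; apply/negP => yx.
have : vge v (Num.min k (v x)) (x - (x - y)).
  by apply: vgeB; [rewrite /vge ge_min lexx !orbT
                  |apply: vge_le kxy; rewrite ge_min lexx].
rewrite opprB addrC subrK /vge (negPf y0) /= ge_min => /orP[].
  by rewrite leNgt vyk.
by rewrite leNgt yx.
Qed.

End DiscreteValuation.

(* Existence of completions, by Cauchy sequences modulo null sequences. *)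
Module CompletionExists.
Section CompletionExists.
Variables (F : fieldType) (v : F -> int).
Hypothesis vP : discrete_valuation v.

Let v1 := dval1 vP.
Let vge0 := vge0 v.
Let vgeN := vgeN vP.
Let vgeD := vgeD vP.
Let vgeB := vgeB vP.
Let vgeM := vgeM vP.
Let vge_eq := vge_eq vP.

Let vcauchy_bounded u : vcauchy v u -> exists b, forall n, vge v b (u n).
Proof.
move=> /(_ 0)[n0 un0].
have [b hb] : exists b, forall n, (n <= n0)%N -> vge v b (u n).
  elim: n0 {un0} => [|n0 [b hb]].
    by exists (v (u 0%N)) => n; rewrite leqn0 => /eqP ->; rewrite /vge lexx orbT.
  exists (Num.min b (v (u n0.+1))) => n; rewrite leq_eqVlt => /orP[/eqP->|nn0].
    by rewrite /vge ge_min lexx !orbT.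
  by apply: vge_le (hb _ nn0); rewrite ge_min lexx.
exists (Num.min b 0) => n; have [nn0|n0n] := leqP n n0.
  by apply: vge_le (hb _ nn0); rewrite ge_min lexx.
rewrite -(subrK (u n0) (u n)); apply: vgeD.
  by apply: vge_le (un0 n n0 (ltnW n0n) (leqnn _)); rewrite ge_min lexx orbT.
by apply: vge_le (hb _ (leqnn _)); rewrite ge_min lexx.
Qed.

Definition cauchy_pred : {pred nat -> F} := fun u => `[< vcauchy v u >].

Let cauchy_subring : subring_closed cauchy_pred.
Proof.
split; rewrite /cauchy_pred.
- apply/asboolP => k; exists 0%N => m n _ _.
  by rewrite (_ : (1 : nat -> F) m - (1 : nat -> F) n = 0) // subrr.
- move=> x y /asboolP cx /asboolP cy; apply/asboolP => k.
  have [n0 h0] := cx k; have [n1 h1] := cy k.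
  exists (maxn n0 n1) => m n; rewrite !geq_max => /andP[m0 m1] /andP[i0 i1].
  have -> : (x - y) m - (x - y) n = (x m - x n) - (y m - y n).
    by rewrite !opprD !opprK addrACA.
  by apply: vgeB; [exact: h0|exact: h1].
- move=> x y /asboolP cx /asboolP cy; apply/asboolP => k.
  have [b hb] := vcauchy_bounded cx; have [c hc] := vcauchy_bounded cy.
  have [n0 h0] := cx (k - c); have [n1 h1] := cy (k - b).
  exists (maxn n0 n1) => m n; rewrite !geq_max => /andP[m0 m1] /andP[i0 i1].
  have -> : (x * y) m - (x * y) n = (x m - x n) * y m + x n * (y m - y n).
    by rewrite mulrBl mulrBr addrA subrK.
  apply: vgeD.
    by rewrite -(subrK c k); apply: vgeM; [exact: h0|exact: hc].
  rewrite -(subrK b k) addrC; apply: vgeM; [exact: hb|].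
  by exact: h1.
Qed.

Definition cauchy_seq := {u : nat -> F | cauchy_pred u}.
HB.instance Definition _ := [isSub for (@sval _ _ : cauchy_seq -> nat -> F)].
HB.instance Definition _ := [Choice of cauchy_seq by <:].
HB.instance Definition _ := 
  GRing.SubChoice_isSubComNzRing.Build _ _ cauchy_seq cauchy_subring.

Definition null_pred : {pred cauchy_seq} := fun u => `[< vcvg v (val u) 0 >].

Let null_ideal : idealr_closed null_pred.
Proof.
split; rewrite /null_pred /in_mem /=.
- apply/asboolP => k; exists 0%N => n _.
  by rewrite (_ : val (0 : cauchy_seq) n - 0 = 0) // subr0.
- apply/asboolP => /(_ 1)[n0 /(_ n0 (leqnn _))].
  rewrite (_ : val (1 : cauchy_seq) n0 - 0 = 1); last by rewrite subr0.
  by rewrite /vge oner_eq0 v1.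
- move=> a x y /asboolP cx /asboolP cy; apply/asboolP => k.
  have [b hb] := vcauchy_bounded (asboolW (valP a)).
  have [n0 h0] := cx (k - b); have [n1 h1] := cy k.
  exists (maxn n0 n1) => n; rewrite !geq_max => /andP[m0 m1].
  have -> : val (a * x + y) n - 0 = val a n * (val x n - 0) + (val y n - 0).
    by rewrite !subr0.
  apply: vgeD; last exact: h1.
  by rewrite -(subrK b k) addrC; apply: vgeM; [exact: hb|exact: h0].
Qed.

HB.instance Definition _ := isIdealr.Build _ null_pred null_ideal.

Local Open Scope quotient_scope.

Definition completed := {ideal_quot null_pred}.
HB.instance Definition _ := GRing.ComNzRing.on completed.
HB.instance Definition _ := Quotient.on completed.

Let piE (x : cauchy_seq) : (\pi_completed x == 0) = null_pred x.
Proof. 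
rewrite -(rmorph0 (\pi_completed)) -[RHS]/(x \in null_pred) -{2}(subr0 x).
by rewrite -Quotient.idealrBE.
Qed.

Let mkseq u (cu : vcauchy v u) : cauchy_seq := exist _ u (asboolT cu).

Definition ev_val (u : nat -> F) (c : int) :=
  exists n0 : nat, forall n, (n0 <= n)%N -> u n != 0 /\ v (u n) = c.

Let ev_val_uniq u c d : ev_val u c -> ev_val u d -> c = d.
Proof.
move=> [n0 h0] [n1 h1]; have [_ <-] := h0 _ (leq_maxl n0 n1).
by have [_ <-] := h1 _ (leq_maxr n0 n1).
Qed.

Let nonnull_ev u : vcauchy v u -> ~ vcvg v u 0 -> exists c, ev_val u c.
Proof.
move=> cu /existsNP[k hk]; have [n0 h0] := cu k.
have /existsNP[n1 /not_implyP[n01 /negP]] :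
    ~ forall n, (n0 <= n)%N -> vge v k (u n - 0).
  by move=> h; apply: hk; exists n0.
rewrite subr0 => nk; exists (v (u n1)), n0 => n n0n.
by apply: (vge_eq nk); exact: h0.
Qed.

Let ev_nonnull u c : ev_val u c -> ~ vcvg v u 0.
Proof.
move=> [n0 h0] /(_ (c + 1))[n1 h1].
have [u0 uc] := h0 _ (leq_maxl n0 n1).
have := h1 _ (leq_maxr n0 n1).
by rewrite subr0 /vge (negPf u0) uc /= leNgt ltrDl.
Qed.

Let inv_ex (q : completed) : q != 0 -> exists p, p * q = 1.
Proof.
elim/quotW: q => x; rewrite piE => nx.
have cx := asboolW (valP x).
have [c [n0 h0]] : exists c, ev_val (val x) c.
  by apply: nonnull_ev => // h; move/negP: nx; apply; exact/asboolP.
have cw : vcauchy v (fun n => (val x n)^-1).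
  move=> k; have [n1 h1] := cx (k + c + c).
  exists (maxn n0 n1) => m n; rewrite !geq_max => /andP[m0 m1] /andP[i0 i1].
  have [xm vm] := h0 _ m0; have [xn vn] := h0 _ i0.
  have vI y : y != 0 -> v y = c -> vge v (- c) y^-1.
    move=> y0 yc; rewrite /vge invr_eq0 (negPf y0) /= -subr_ge0 opprK.
    have := dvalM vP y0 (invr_neq0 y0).
    by rewrite mulfV // v1 yc addrC => <-.
  have -> : (val x m)^-1 - (val x n)^-1 =
      (val x n - val x m) * (val x m)^-1 * (val x n)^-1.
    rewrite mulrBl mulfV // mulrBl mul1r mulrAC mulfV // mul1r.
    by [].
  have -> : k = (k + c + c) - c - c by rewrite !addrK.
  by rewrite !vgeM ?vI // h1.
exists (\pi_completed (mkseq cw)).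
apply/eqP; rewrite -subr_eq0 -(rmorph1 (\pi_completed)) -rmorphM -rmorphB piE.
apply/asboolP => k; exists n0 => n n0n.
have [xn _] := h0 _ n0n.
rewrite [X in X - 0](_ : _ = (val x n)^-1 * val x n - 1) //.
by rewrite mulVf // !subrr.
Qed.

Definition completed_inv (q : completed) : completed :=
  if q == 0 then 0 else xget 0 [set p | p * q = 1].

Let completed_mulV q : q != 0 -> completed_inv q * q = 1.
Proof.
move=> q0; rewrite /completed_inv (negPf q0).
by have [p /= hp] := inv_ex q0; exact: (@xgetPex _ 0 [set p | p * q = 1]) (ex_intro _ p hp).
Qed.

Let completed_inv0 : completed_inv 0 = 0.
Proof. by rewrite /completed_inv eqxx. Qed.

HB.instance Definition _ :=
  GRing.ComNzRing_isField.Build completed completed_mulV completed_inv0.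

Definition completed_val (q : completed) : int :=
  xget 0 [set c | ev_val (val (repr q)) c].

Let ev_pi x c : ev_val (val x) c -> completed_val (\pi_completed x) = c.
Proof.
move=> ec; rewrite /completed_val; set y := repr _.
have yx : \pi_completed y = \pi_completed x by exact: reprK.
have : \pi_completed x - \pi_completed y == 0 by rewrite yx subrr.
rewrite -rmorphB piE => /asboolP xy.
suff : ev_val (val y) c.
  move=> yc; apply: (ev_val_uniq _ yc).
  exact: (@xgetPex _ 0 [set c | ev_val (val y) c]) (ex_intro _ c yc).
have [n0 h0] := ec; have [n1 h1] := xy (c + 1).
exists (maxn n0 n1) => n; rewrite geq_max => /andP[i0 i1].
have [x0 xc] := h0 _ i0; rewrite -xc.
apply: (@vge_eq (c + 1)).
  by rewrite /vge (negPf x0) xc /= -ltNge ltrDl.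
by rewrite -vgeN opprB; move: (h1 _ i1); rewrite subr0.
Qed.

Let pi_ev x : \pi_completed x != 0 -> ev_val (val x) (completed_val (\pi_completed x)).
Proof.
rewrite piE => nx; have [c ec] : exists c, ev_val (val x) c.
  apply: nonnull_ev; first exact: asboolW (valP x).
  by move=> h; move/negP: nx; apply; exact/asboolP.
by rewrite (ev_pi ec).
Qed.

Let completed_val0 : completed_val 0 = 0.
Proof.
rewrite /completed_val; case: xgetP => // c _ /= /ev_nonnull; case.
apply/asboolP; rewrite -[X in is_true X]/(null_pred _) -piE.
by apply/eqP; exact: reprK.
Qed.

Let pi_vge k x : vge completed_val k (\pi_completed x) <->
  exists n0 : nat, forall n, (n0 <= n)%N -> vge v k (val x n).
Proof.
have [x0|x0] := eqVneq (\pi_completed x) 0.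
  rewrite {1}/vge x0 eqxx; split=> // _.
  move/eqP: x0; rewrite piE => /asboolP/(_ k)[n0 h0].
  by exists n0 => n /h0; rewrite subr0.
rewrite {1}/vge (negPf x0) /=; have [n0 h0] := pi_ev x0; split.
  by move=> h; exists n0 => n /h0[xn xc]; rewrite /vge xc h orbT.
move=> [n1 h1]; have [xn <-] := h0 _ (leq_maxl n0 n1).
by have := h1 _ (leq_maxr n0 n1); rewrite /vge (negPf xn).
Qed.

Let cst_cauchy (x : F) : vcauchy v (fun=> x).
Proof. by move=> k; exists 0%N => m n _ _; rewrite subrr. Qed.

Definition completed_emb (x : F) : completed :=
  \pi_completed (mkseq (cst_cauchy x)).

Let completed_emb_zmod : zmod_morphism completed_emb.
Proof.
move=> x y; rewrite /completed_emb -rmorphB; congr (\pi_completed _).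
exact/val_inj.
Qed.

Let completed_emb_monoid : monoid_morphism completed_emb.
Proof.
split=> [|x y].
  by rewrite -(rmorph1 (\pi_completed)); congr (\pi_completed _); exact/val_inj.
by rewrite /completed_emb -rmorphM; congr (\pi_completed _); exact/val_inj.
Qed.

HB.instance Definition _ :=
  GRing.isZmodMorphism.Build F completed completed_emb completed_emb_zmod.
HB.instance Definition _ :=
  GRing.isMonoidMorphism.Build F completed completed_emb completed_emb_monoid.

Let completed_embP x : completed_val (completed_emb x) = v x.
Proof.
have [->|x0] := eqVneq x 0; first by rewrite rmorph0 completed_val0 (dval0 vP).
by apply: ev_pi; exists 0%N.
Qed.

Let completed_valP : discrete_valuation completed_val.
Proof.
split=> //.
- elim/quotW => x; elim/quotW => y x0 y0; rewrite -rmorphM; apply: ev_pi.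
  have [n0 h0] := pi_ev x0; have [n1 h1] := pi_ev y0.
  exists (maxn n0 n1) => n; rewrite geq_max => /andP[/h0[a <-] /h1[b <-]].
  by rewrite -(dvalM vP) //; split=> //; rewrite mulf_neq0.
- elim/quotW => x; elim/quotW => y x0 y0.
  rewrite -rmorphD => s0; move: (pi_ev s0) => [n2 h2].
  have [n0 h0] := pi_ev x0; have [n1 h1] := pi_ev y0.
  pose n := maxn n0 (maxn n1 n2).
  have [s sn] : val (x + y) n != 0 /\ v (val (x + y) n) = completed_val (\pi_completed (x + y)).
    by apply: h2; rewrite !leq_max leqnn !orbT.
  have [a an] : val x n != 0 /\ v (val x n) = completed_val (\pi_completed x).
    by apply: h0; rewrite !leq_max leqnn.
  have [b bn] : val y n != 0 /\ v (val y n) = completed_val (\pi_completed y).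
    by apply: h1; rewrite !leq_max leqnn !orbT.
  by rewrite -sn -an -bn; exact: dvalD.
- have [x x0 vx] := dval_surj vP; exists (completed_emb x).
    by rewrite fmorph_eq0.
  by rewrite completed_embP.
Qed.

Let completed_dense (y : completed) k :
  exists x, vge completed_val k (y - completed_emb x).
Proof.
elim/quotW: y => x; have [n0 h0] := asboolW (valP x) k.
exists (val x n0); rewrite -rmorphB; apply/pi_vge; exists n0 => n n0n.
exact: h0.
Qed.

Let completed_complete u : vcauchy completed_val u ->
  exists y, vcvg completed_val u y.
Proof.
move=> cu; have /choice[x hx] n := completed_dense (u n) n%:Z.
have embD k a : vge v k a = vge completed_val k (completed_emb a).
  by rewrite /vge completed_embP fmorph_eq0.
have cx : vcauchy v x.
  move=> k; have [n0 h0] := cu k; exists (maxn n0 `|k|%N) => m n.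
  rewrite !geq_max => /andP[m0 m1] /andP[i0 i1].
  have hxk i : (`|k| <= i)%N -> vge completed_val k (u i - completed_emb (x i)).
    by move=> ki; apply: vge_le (hx i); rewrite (le_trans (ler_norm k))// -abszE lez_nat.
  rewrite embD rmorphB.
  rewrite (_ : _ - _ = (u m - u n) - (u m - completed_emb (x m))
                       + (u n - completed_emb (x n))); last first.
    by rewrite opprB (addrC (u m - u n)) !addrA !subrK.
  apply: (Defs.vgeD completed_valP); last exact: hxk.
  by apply: (Defs.vgeB completed_valP); [exact: h0 | exact: hxk].
exists (\pi_completed (mkseq cx)) => k; have [n0 h0] := cx k.
exists (maxn n0 `|k|%N) => n; rewrite geq_max => /andP[n0n kn].
rewrite -(subrK (completed_emb (x n)) (u n)) -addrA.
apply: (Defs.vgeD completed_valP).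
  by apply: vge_le (hx n); rewrite (le_trans (ler_norm k))// -abszE lez_nat.
have -> : completed_emb (x n) - \pi_completed (mkseq cx) =
    \pi_completed (mkseq (cst_cauchy (x n)) - mkseq cx) by rewrite rmorphB.
by apply/pi_vge; exists n0 => m n0m; exact: h0.
Qed.

Lemma completion_exists : inhabited (completion v).
Proof.
split; exact: (@Completion F v completed completed_val completed_emb
  completed_valP completed_embP completed_dense completed_complete).
Qed.

End CompletionExists.
End CompletionExists.
Notation completion_exists := CompletionExists.completion_exists.

(* A prime of a number field K is a (finite) place, given by its unique
   normalised discrete valuation ord_p : K^* ->> Z; these correspond to the
   nonzero prime ideals of the ring of integers of K. *)
Record prime_place (K : fieldType) := PrimePlace {
  place_ord :> K -> int;
  place_ordP : `[< discrete_valuation place_ord >] }.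

HB.instance Definition _ (K : fieldType) := [isSub for @place_ord K].
HB.instance Definition _ (K : fieldType) := [Choice of prime_place K by <:].

(* K_p, which is determined up to a unique isometric isomorphism over K *)
Definition place_completion (K : fieldType) (p : prime_place K) :
    completion p :=
  inhabited_witness (completion_exists (asboolW (place_ordP p))).

(* N(p): the cardinality of the residue field, whose elements are the cosets
   x + {y | ord_p y >= 1} with ord_p x >= 0. *)
Definition place_norm (K : fieldType) (p : prime_place K) : nat :=
  #|` fset_set [set [set y | vge p 1 (y - x)] | x in [set x | vge p 0 x]]|%fset.

(* ||x||_p = N(p)^(- ord_p x) *)
Definition place_abs (R : realType) (K : fieldType) (p : prime_place K)
    (x : K) : R :=
  if x == 0 then 0 else (place_norm p)%:R ^ (- p x).

Definition complex_embeddings (R : realType) (K : fieldType) :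
    set (K -> R[i]) :=
  [set s | exists g : {rmorphism K -> R[i]}, s = g :> (K -> R[i])].

(* Absolute logarithmic height of the point of P^N(K) with homogeneous
   coordinates x != 0.  Summing over all embeddings counts each complex place
   twice, as its local degree requires; at p the exponent [K_p : Q_p] is part
   of ||.||_p.  By the product formula the value depends only on the point. *)
Definition weil_height (R : realType) (K : fieldExtType rat) (N : nat)
    (x : 'rV[K]_N.+1) : R :=
  (\sum_(s \in @complex_embeddings R K)
      ln (\big[Num.max/0]_(j < N.+1) Normc.normc (s (x 0 j)))
   + \sum_(p \in [set: prime_place K])
      ln (\big[Num.max/0]_(j < N.+1) place_abs R p (x 0 j)))
  / (\dim {:K})%:R.

(* Points of P^N are given by nonzero row vectors (x_0, ..., x_N) up to
   scaling; A^N is the chart x_0 != 0, with P = (1 : P_1 : ... : P_N), and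
   x_0 = 0 is the hyperplane at infinity. *)
Definition same_point (K : fieldType) (N : nat) (x y : 'rV[K]_N.+1) : Prop :=
  exists2 c : K, c != 0 & x = c *: y.

Definition affine_point (K : fieldType) (N : nat) (P : 'rV[K]_N) :
    'rV[K]_N.+1 :=
  \row_j (if unlift ord0 j is Some i then P 0 i else 1).

(* A subset of P^N(L) is represented by its preimage in L^(N+1) \ {0}. *)
Definition projective_set (L : fieldType) (N : nat) (U : set 'rV[L]_N.+1) :
    Prop :=
  (forall x, U x -> x != 0) /\ (forall c x, c != 0 -> U x -> U (c *: x)).

(* The topology of P^N(L) is the quotient topology from L^(N+1) \ {0}; since
   the quotient map is open and U is a cone, it is enough to test one vector x
   of homogeneous coordinates. *)
Definition projective_nbhs (L : fieldType) (v : L -> int) (N : nat)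
    (x : 'rV[L]_N.+1) (U : set 'rV[L]_N.+1) : Prop :=
  projective_set U /\
  exists k : int, forall y : 'rV[L]_N.+1, (forall j, vge v k (y 0 j - x 0 j)) -> U y.

Notation mpoly := mpoly.mpoly.
Local Notation "p .-homog" := (mpoly.ishomog1 p mpoly.mdeg)
  (at level 1, format "p .-homog").
Local Notation "''x_' i" := (mpoly.mpolyX _ (mpoly.mnm1 i))
  (at level 8, i at level 2, format "''x_' i").

Section PolynomialMaps.
Variables (K : fieldType) (N : nat).
Implicit Types f g : N.-tuple (mpoly N K).

Definition affine_eval f (P : 'rV[K]_N) : 'rV[K]_N :=
  \row_i mpoly.meval (P 0) (tnth f i).

(* g o f *)
Definition affine_comp g f : N.-tuple (mpoly N K) :=
  [tuple mpoly.comp_mpoly f (tnth g i) | i < N].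

Definition affine_iter f (n : nat) : N.-tuple (mpoly N K) :=
  iter n (affine_comp f) [tuple 'x_i | i < N].

(* X_0^d p(X_1/X_0, ..., X_N/X_0), for d at least the degree of p *)
Definition homogenize (d : nat) (p : mpoly N K) : mpoly N.+1 K :=
  \sum_(m <- mpoly.msupp p) mpoly.mcoeff m p *:
    ('x_ord0 ^+ (d - mpoly.mdeg m) *
     \prod_(i < N) 'x_(fintype.lift ord0 i) ^+ m i).

Definition affine_degree f : nat :=
  \max_(i < N) (mpoly.mmeasure mpoly.mdeg (tnth f i)).-1.

(* The rational self-map of P^N extending f, in homogeneous coordinates; the
   components have no common factor, as some homogenize _ (tnth f i) is not
   divisible by X_0. *)
Definition projective_extension f : N.+1.-tuple (mpoly N.+1 K) :=
  let d := affine_degree f in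
  [tuple if unlift ord0 j is Some i then homogenize d (tnth f i)
         else 'x_ord0 ^+ d | j < N.+1].

End PolynomialMaps.

Section RationalMaps.
Variables (K : fieldType) (N : nat).
Implicit Types (F G : N.+1.-tuple (mpoly N.+1 K)) (A B : mpoly N.+1 K).

Definition projective_eval F (x : 'rV[K]_N.+1) : 'rV[K]_N.+1 :=
  \row_j mpoly.meval (x 0) (tnth F j).

(* The image is contained in no hypersurface A = 0. *)
Definition dominant F : Prop :=
  forall d A, A \is d.-homog -> A != 0 -> mpoly.comp_mpoly F A != 0.

(* The rational map F is defined at x, with value y: it is represented near x
   by forms G of the same degree, proportional to F and not all zero at x. *)
Definition defined_with_value F (x y : 'rV[K]_N.+1) : Prop :=
  exists (d : nat) G,
    [/\ forall j, tnth G j \is d.-homog,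
        forall i j, tnth G i * tnth F j = tnth G j * tnth F i,
        projective_eval G x != 0
      & same_point (projective_eval G x) y].

(* NS(P^N) (x) C: divisors are formal sums of hypersurfaces, a hypersurface
   being a nonzero form A, modulo div(AB) = div(A) + div(B) and div(A) ~ div(B)
   for A, B of the same degree, i.e. linear equivalence, which on P^N coincides
   with algebraic equivalence.  Complex coefficients give access to all the
   eigenvalues of an endomorphism of NS(P^N)_R. *)
Definition is_form A : bool :=
  (A != 0) && (A \is mpoly.ishomog mpoly.mdeg).

Definition is_divisor (R : realType) (D : {freeg (mpoly N.+1 K) / R[i]}) :
    bool :=
  all is_form (dom D).

Inductive ns_trivial (R : realType) : {freeg (mpoly N.+1 K) / R[i]} -> Prop :=
| ns_trivial0 : ns_trivial 0
| ns_trivialD D E : ns_trivial D -> ns_trivial E -> ns_trivial (D + E)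
| ns_trivialZ (c : R[i]) D : ns_trivial D -> ns_trivial (c *: D)
| ns_trivialM A B : is_form A -> is_form B ->
    ns_trivial (<< A * B >> - << A >> - << B >>)
| ns_trivial_lin d A B : A != 0 -> B != 0 ->
    A \is d.-homog -> B \is d.-homog -> ns_trivial (<< A >> - << B >>).

(* The pullback of the hypersurface A = 0 by F, in coordinates without common
   factor, is A(F_0, ..., F_N) = 0. *)
Definition pullback (R : realType) F :
    {freeg (mpoly N.+1 K) / R[i]} -> {freeg (mpoly N.+1 K) / R[i]} :=
  fglift (fun A => << mpoly.comp_mpoly F A >>).

Definition ns_eigenvalue (R : realType) F (l : R[i]) : Prop :=
  exists D, [/\ is_divisor D, ~ ns_trivial D
              & ns_trivial (pullback F D - l *: D)].

Definition ns_spectral_radius (R : realType) F : R :=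
  sup [set Normc.normc l | l in @ns_eigenvalue R F].

End RationalMaps.

(* For dominant f the n-th iterate of the rational map extending f is the
   extension of the n-th iterate of f. *)
Definition dynamical_degree (R : realType) (K : fieldType) (N : nat)
    (f : N.-tuple (mpoly N K)) : R :=
  limn (fun n : nat =>
    ns_spectral_radius R (projective_extension (affine_iter f n))
      `^ (n%:R)^-1).

Definition lower_canonical_height (R : realType) (K : fieldExtType rat)
    (N : nat) (f : N.-tuple (mpoly N K)) (P : 'rV[K]_N) : \bar R :=
  limn_einf (fun n : nat =>
    (weil_height R (affine_point (iter n (affine_eval f) P))
       / dynamical_degree R f ^+ n)%:E).

(* Main.v *)
(* Q0 is a superattracting fixed point of g = f^m in the direction of the
   hyperplane at infinity.  Write D for the degree of g and take coordinates
   with q_j = 1 for Q0 = (q_0 : ... : q_N), so that q_0 = 0.  At a prime p where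
   f, g and q are integral and g(q) = l q with l a unit, the residue disk of q
   is stable under the lift of g, and the component x_j of a point x = (1 : P)
   of the disk satisfies ord_p(g(x)_j) = D ord_p(x_j) with ord_p(x_j) < 0.
   Hence the local height at p of f^(mk)(P) is at least a constant times D^k,
   and D >= delta^m because the eigenvalues of f^* on NS(P^N) are deg f and
   degrees are submultiplicative.  Integrality of f itself bounds the local
   heights of the intermediate iterates from below.  All local heights of
   (1 : P) being nonnegative, the local height at p bounds the global one, as
   soon as the sum over all places has finite support.

   Two facts about the places of K are needed.  Only finitely many places are
   negative at a given element: places above a rational prime l are separated
   by elements, obtained by weak approximation, that are linearly independent
   over Q.  And there are places with finite residue field at which finitely
   many given elements are integral: if K = Q(theta) and the minimal polynomial
   of theta has a simple root modulo l, Hensel's lemma embeds K in Q_l. *)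

Require Import Defs.
From HB Require Import structures.
From mathcomp Require Import all_boot all_order all_algebra all_field.
From mathcomp Require Import all_classical all_reals all_analysis.
From mathcomp Require Import finmap complex freeg.
From mathcomp Require Import (canonicals, coercions, hints) mpoly.
From mathcomp Require Import zify ring.

Set Implicit Arguments.
Unset Strict Implicit.
Unset Printing Implicit Defensive.

Import Order.TTheory GRing.Theory Num.Theory.
Local Open Scope classical_set_scope.
Local Open Scope ring_scope.

(** * Discrete valuations and places *)

(** With [a = v x] negative, this puts the valuation of [x ^+ n] strictly below those of all lower
    powers. *)
Lemma ler_nmulrn_lt (a : int) (i n : nat) :
  a < 0 -> (i < n)%N -> a *+ n + 1 <= a *+ i.
Proof.
move=> a0 lin; rewrite -(mulr_natr a n) -(mulr_natr a i) !natz.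
have : (a + 1) * (n%:Z - i%:Z) <= 0 by rewrite mulr_le0_ge0; lia.
by rewrite mulrDl mul1r mulrBr; lia.
Qed.

Section Valuations.
Variables (F : fieldType) (v : F -> int).
Hypothesis vP : discrete_valuation v.

Lemma dvalV x : x != 0 -> v x^-1 = - v x.
Proof.
move=> x0; have := dvalM vP x0 (invr_neq0 x0).
by rewrite mulfV // (dval1 vP) => /esym/eqP; rewrite addr_eq0 => /eqP ->; rewrite opprK.
Qed.

Lemma dvalX x n : x != 0 -> v (x ^+ n) = v x *+ n.
Proof.
move=> x0; elim: n => [|n IH]; first by rewrite expr0 (dval1 vP).
by rewrite exprS (dvalM vP) ?expf_neq0 // IH mulrS.
Qed.

Lemma dval_exprz x (n : int) : x != 0 -> v (x ^ n) = v x * n.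
Proof.
move=> x0; case: n => n; first by rewrite -exprnP dvalX // -mulr_natr natz.
by rewrite NegzE -exprz_inv dvalX ?invr_eq0 // dvalV // mulNrn mulrN -mulr_natr natz.
Qed.

Lemma vge1 : vge v 0 1.
Proof. by rewrite /vge (dval1 vP) lexx orbT. Qed.

Lemma vge_sum k (I : Type) (r : seq I) (P : pred I) (E : I -> F) :
  (forall i, P i -> vge v k (E i)) -> vge v k (\sum_(i <- r | P i) E i).
Proof.
by move=> h; elim/big_ind: _ => //; [exact: vge0 | move=> *; exact: (vgeD vP)].
Qed.

Lemma vge_mul0 k x y : vge v 0 x -> vge v k y -> vge v k (x * y).
Proof. by move=> hx hy; rewrite -[k]add0r; exact: (vgeM vP). Qed.

Lemma vgeX k n x : vge v k x -> vge v (k *+ n) (x ^+ n).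
Proof.
move=> h; elim: n => [|n IH]; first by rewrite expr0 mulr0n vge1.
by rewrite exprS mulrS; exact: (vgeM vP).
Qed.

Lemma vge_int (n : int) : vge v 0 n%:~R.
Proof.
wlog : n / exists m, n = Posz m => [H|[m ->]].
  case: n => n; first by apply: H; exists n.
  by rewrite NegzE rmorphN /= (vgeN vP); apply: H; exists n.+1.
rewrite -pmulrn; elim: m => [|m IH]; first by rewrite mulr0n vge0.
by rewrite mulrS; apply: (vgeD vP) => //; exact: vge1.
Qed.

Lemma vge_nat (n : nat) : vge v 0 n%:R.
Proof. by rewrite pmulrn vge_int. Qed.

Lemma vgeP k x : x != 0 -> vge v k x = (k <= v x).
Proof. by rewrite /vge => /negPf ->. Qed.

(** By induction along Horner's scheme, [x - y] divides the difference with an integral cofactor. *)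
Lemma vge_horner_sub k (p : {poly F}) x y : (forall i, vge v 0 p`_i) ->
  vge v 0 x -> vge v 0 y -> vge v k (x - y) -> vge v k (p.[x] - p.[y]).
Proof.
elim/poly_ind: p => [|p c IH] hp hx hy hxy; first by rewrite !horner0 subrr vge0.
have hp' i : vge v 0 p`_i.
  by have := hp i.+1; rewrite coefD coefMX coefC /= addr0.
rewrite !hornerMXaddC opprD addrACA subrr addr0.
have -> : p.[x] * x - p.[y] * y = x * (p.[x] - p.[y]) + p.[y] * (x - y) by ring.
apply: (vgeD vP); apply: vge_mul0 => //; first exact: IH.
rewrite horner_coef; apply: vge_sum => i _; apply: vge_mul0 => //.
by have := vgeX i hy; rewrite mul0rn.
Qed.

Lemma vge_horner (p : {poly F}) x :
  (forall i, vge v 0 p`_i) -> vge v 0 x -> vge v 0 p.[x].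
Proof.
move=> hp hx; rewrite horner_coef; apply: vge_sum => i _; apply: vge_mul0 => //.
by have := vgeX i hx; rewrite mul0rn.
Qed.

(** Valuation rings are integrally closed: if [v x < 0], the leading term has valuation strictly
    below the others and cannot cancel against them. *)
Lemma vge_root (p : {poly F}) x : p \is monic -> (forall i, vge v 0 p`_i) ->
  root p x -> vge v 0 x.
Proof.
move=> mp hp /rootP px; have [->|x0] := eqVneq x 0; first exact: vge0.
rewrite vgeP // leNgt; apply/negP => vx.
have sp : (0 < size p)%N by rewrite size_poly_gt0 monic_neq0.
move: px; rewrite horner_coef -(prednK sp) big_ord_recr /=.
rewrite -lead_coefE (monicP mp) mul1r => /eqP; rewrite addrC addr_eq0 => /eqP e.
set n := (size p).-1 in e.
have : vge v (v x *+ n + 1) (x ^+ n).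
  rewrite e (vgeN vP); apply: vge_sum => i _; apply: vge_mul0 => //.
  rewrite vgeP ?expf_neq0 // dvalX //.
  exact: ler_nmulrn_lt (ltn_ord i).
by rewrite vgeP ?expf_neq0 // dvalX // gerDl.
Qed.

Lemma vge_unit x : x != 0 -> vge v 0 x -> vge v 0 x^-1 -> v x = 0.
Proof.
move=> x0; rewrite !vgeP ?invr_eq0 // dvalV // oppr_ge0 => a b.
by apply/eqP; rewrite eq_le a b.
Qed.

Lemma dval_add_gt x y : x != 0 -> v x = 0 -> vge v 1 (y - x) ->
  y != 0 /\ v y = 0.
Proof.
by move=> x0 vx h; have := @vge_eq _ _ vP 1 y x; rewrite vgeP // vx => /(_ isT h).
Qed.

End Valuations.

(** Units for [v] are units for [w], so writing [x] as a unit times a power of a uniformiser [pi]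
    gives [w x = w pi * v x]. Surjectivity of [w] and [0 <= w pi] then force [w pi = 1]. *)
Lemma dval_eq_of_ge0 (F : fieldType) (v w : F -> int) :
  discrete_valuation v -> discrete_valuation w ->
  (forall x, x != 0 -> 0 <= v x -> 0 <= w x) -> v = w.
Proof.
move=> vP wP sub.
have u0 x : x != 0 -> v x = 0 -> w x = 0.
  move=> x0 vx; apply: (vge_unit wP x0); rewrite vgeP ?invr_eq0 // ?sub ?invr_eq0 //.
    by rewrite vx.
  by rewrite (dvalV vP) // vx oppr0.
have [pi pi0 vpi] := dval_surj vP.
have wE x : x != 0 -> w x = w pi * v x.
  move=> x0; have := u0 (x * pi ^ (- v x)).
  have p0 : pi ^ (- v x) != 0 by rewrite expfz_neq0.
  rewrite mulf_neq0 // (dvalM vP) // (dvalM wP) // !dval_exprz // vpi mul1r subrr.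
  by move=> /(_ isT erefl) /eqP; rewrite mulrN subr_eq0 => /eqP.
have wpi : w pi = 1.
  have [x x0 wx] := dval_surj wP; have := sub pi pi0; rewrite vpi => /(_ isT) p0.
  move: wx; rewrite wE //; move: (w pi) (v x) p0 => a b a0 ab.
  have [b0|b0] : b <= 0 \/ 1 <= b; [by lia | by nia | by nia].
apply/funext => x; have [->|x0] := eqVneq x 0; first by rewrite (dval0 vP) (dval0 wP).
by rewrite wE // wpi mul1r.
Qed.

(** * Distinct places of a field: separation and weak approximation *)

Section Places.
Variable K : fieldType.
Implicit Types (p q : prime_place K) (s : seq (prime_place K)).

Lemma placeP p : discrete_valuation p.
Proof. exact: asboolW (place_ordP p). Qed.

(** By [dval_eq_of_ge0] neither valuation ring contains the other; the quotient of the two witnesses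
    separates the places. *)
Lemma place_separate p q : p != q -> exists z, [/\ z != 0, p z < 0 & 0 < q z].
Proof.
have sep p1 q1 : p1 != q1 -> exists x, [/\ x != 0, 0 <= p1 x & q1 x < 0].
  move=> pq; apply: contrapT => h; case/negP: pq; apply/eqP/val_inj.
  apply: dval_eq_of_ge0; [exact: placeP | exact: placeP |] => x x0 px.
  by rewrite leNgt; apply/negP => qx; apply: h; exists x.
move=> pq; have [x [x0 px qx]] := sep _ _ pq.
have [y [y0 qy py]] := sep q p (contra_neq (@esym _ q p) pq).
exists (y / x).
rewrite mulf_neq0 ?invr_eq0 // !(dvalM (placeP _)) ?invr_eq0 // !(dvalV (placeP _)) //.
by split=> //; lia.
Qed.

(* [x^k / (1 + x^k)] tends to [1] at the places where [x] is large and to [0]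
   at those where it is small. *)
Lemma place_damp p x k : x != 0 -> p x != 0 -> (0 < k)%N ->
  [/\ 1 + x ^+ k != 0 , p x < 0 -> p (x ^+ k / (1 + x ^+ k)) = 0
    & 0 < p x -> p (x ^+ k / (1 + x ^+ k)) = p x *+ k].
Proof.
move=> x0 px k0; have pP := placeP p.
have xk0 : x ^+ k != 0 by rewrite expf_neq0.
have vk := dvalX pP k x0.
have [pxn|pxp] : p x < 0 \/ 0 < p x by lia.
  have h : p x *+ k < 0 by rewrite -mulr_natr natz; nia.
  have [s0 s1] : 1 + x ^+ k != 0 /\ p (1 + x ^+ k) = p (x ^+ k).
    apply: (@vge_eq _ _ pP 0); first by rewrite vgeP // vk -ltNge.
    by rewrite addrK vge1.
  split=> // [_|]; last by lia.
  by rewrite (dvalM pP) ?invr_eq0 // (dvalV pP) // s1 subrr.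
have h : 1 <= p x *+ k by rewrite -mulr_natr natz; nia.
have [s0 s1] : 1 + x ^+ k != 0 /\ p (1 + x ^+ k) = 0.
  apply: (@dval_add_gt _ _ pP 1); rewrite ?oner_eq0 ?(dval1 pP) //.
  by rewrite addrC addKr vgeP // vk.
split=> // [|_]; first by lia.
by rewrite (dvalM pP) ?invr_eq0 // (dvalV pP) // s1 subr0.
Qed.

(** Induction on [s]: [z] handles the old places, [w] separates [p] from the new place [q], and a
    high power of [z] corrects the values of [w] on [s]. *)
Lemma place_approx_neg p s : p \notin s ->
  exists z, [/\ z != 0, p z < 0 & {in s, forall q, 0 < q z}].
Proof.
elim: s => [_|q s IH].
  have [x x0 px] := dval_surj (placeP p); exists x^-1.
  by rewrite invr_eq0 (dvalV (placeP p)) // px; split.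
rewrite inE negb_or => /andP[pq /IH[z [z0 pz sz]]].
have [w [w0 pw qw]] := place_separate pq.
(* [b] exceeds every |r(w)|, so b r(z) outweighs any pole of [w] in [s]. *)
pose b := (\max_(r <- s) `|r w|).+1%N.
have bP r : r \in s -> (`|r w| < b)%N.
  move=> rs; rewrite ltnS.
  exact: (@leq_bigmax_seq _ _ predT (fun r : prime_place K => `|r w|%N)).
have b0 : (0 < b)%N by [].
have [qz|qz] := lerP 0 (q z).
  exists (w * z ^+ b).
  have zb : z ^+ b != 0 by rewrite expf_neq0.
  rewrite mulf_neq0 //; split=> //.
    rewrite (dvalM (placeP p)) // (dvalX (placeP p)) // -mulr_natr natz; nia.
  move=> r; rewrite inE (dvalM (placeP r)) // (dvalX (placeP r)) // -mulr_natr natz.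
  case/predU1P => [->|rs]; first by nia.
  have := bP _ rs; have := sz _ rs; nia.
(* Here [z] has a pole at [q] too; damping its power gives a unit at both [p] and [q], where [w]
   alone already has the right signs. *)
have [s0 sp _] := @place_damp p z b z0 (ltr0_neq0 pz) b0.
have zb : z ^+ b / (1 + z ^+ b) != 0 by rewrite mulf_neq0 ?invr_eq0 ?expf_neq0.
exists (w * (z ^+ b / (1 + z ^+ b))); split; first by rewrite mulf_neq0.
  by rewrite (dvalM (placeP p)) // sp // addr0.
move=> r; rewrite inE (dvalM (placeP r)) //.
case/predU1P => [->|rs].
  have [_ sq _] := @place_damp q z b z0 (ltr0_neq0 qz) b0.
  by rewrite sq // addr0.
have rz := sz _ rs.
have [_ _ ->//] := @place_damp r z b z0 (lt0r_neq0 rz) b0.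
rewrite -mulr_natr natz; have := bP _ rs; nia.
Qed.

(** One damping turns the pole at [p] into a unit and keeps the zeros on [s]. *)
Lemma place_approx p s : p \notin s ->
  exists z, [/\ z != 0, p z = 0 & {in s, forall q, 0 < q z}].
Proof.
case/place_approx_neg => z [z0 pz sz].
have [s0 sp _] := @place_damp p z 1 z0 (ltr0_neq0 pz) isT.
exists (z ^+ 1 / (1 + z ^+ 1)); split; first by rewrite mulf_neq0 ?invr_eq0.
  exact: sp.
move=> q /sz qz; have [_ _ ->//] := @place_damp q z 1 z0 (lt0r_neq0 qz) isT.
Qed.

End Places.

(** * The l-adic valuation of Q *)

Definition padic (l : nat) (x : rat) : int :=
  (logn l `|numq x|)%:Z - (logn l `|denq x|)%:Z.

Section Padic.
Variable l : nat.
Hypothesis l_pr : prime l.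

(** Allowing unreduced fractions lets [padicP] add over a common denominator. *)
Lemma padicE (a b : int) : a != 0 -> b != 0 ->
  padic l (a%:~R / b%:~R) = (logn l `|a|)%:Z - (logn l `|b|)%:Z.
Proof.
move=> a0 b0; set x : rat := _ / _.
have bQ : (b%:~R : rat) != 0 by rewrite intr_eq0.
have x0 : x != 0 by rewrite mulf_neq0 ?invr_eq0 ?intr_eq0.
have /(congr1 absz) : numq x * b = a * denq x.
  have dQ : (denq x)%:~R != 0 :> rat by rewrite intr_eq0 denq_neq0.
  apply: (@intr_inj rat); rewrite !rmorphM /= -[X in X * _](mulfVK dQ).
  by rewrite divq_num_den /x; field.
rewrite !abszM => /(congr1 (logn l)).
rewrite !lognM ?absz_gt0 ?numq_eq0 ?denq_neq0 // /padic; lia.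
Qed.

Lemma padicP : discrete_valuation (padic l).
Proof.
have E x : x != 0 :> rat -> exists a b : int, [/\ a != 0, b != 0 & x = a%:~R / b%:~R].
  by move=> x0; exists (numq x), (denq x); rewrite numq_eq0 denq_neq0 divq_num_den.
have Q0 (b : int) : b != 0 -> (b%:~R : rat) != 0 by rewrite intr_eq0.
split.
- by rewrite /padic /= ?logn0 ?logn1.
- move=> x y /E[a [b [a0 b0 ->]]] /E[c [d [c0 d0 ->]]].
  rewrite mulf_div -!rmorphM /= !padicE ?mulf_neq0 // !abszM.
  rewrite !lognM ?absz_gt0 //; lia.
- move=> x y /E[a [b [a0 b0 xE]]] /E[c [d [c0 d0 yE]]].
  have {}xE : x = (a * d)%:~R / (b * d)%:~R.
    by rewrite xE !rmorphM /=; field; rewrite !Q0.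
  have {}yE : y = (c * b)%:~R / (b * d)%:~R.
    by rewrite yE !rmorphM /=; field; rewrite !Q0.
  rewrite xE yE -mulrDl -rmorphD /= => s0.
  have {}s0 : a * d + c * b != 0.
    by apply: contraNneq s0 => ->; rewrite mul0r.
  rewrite !padicE ?mulf_neq0 //.
  set u := a * d in s0 *; set w := c * b in s0 *.
  have u0 : u != 0 by rewrite mulf_neq0.
  have w0 : w != 0 by rewrite mulf_neq0.
  pose k := minn (logn l `|u|) (logn l `|w|).
  have : (k <= logn l `|(u + w)%R|)%N.
    rewrite -pfactor_dvdn ?absz_gt0 //.
    have du : ((l ^ k)%N %| u)%Z by rewrite dvdzE /= pfactor_dvdn ?absz_gt0 // geq_minl.
    have dw : ((l ^ k)%N %| w)%Z by rewrite dvdzE /= pfactor_dvdn ?absz_gt0 // geq_minr.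
    by have := rpredD du dw; rewrite dvdzE.
  by rewrite ge_min !lerD2r !lez_nat -geq_min.
- exists (l%:Z%:~R / 1%:~R); first by rewrite divr1 intr_eq0; have := prime_gt0 l_pr; lia.
  rewrite (@padicE l%:Z 1) //; last by have := prime_gt0 l_pr; lia.
  by rewrite /= logn_prime // eqxx logn1.
Qed.

Lemma padic_nat : padic l l%:R = 1.
Proof.
have l0 : l%:Z != 0 by have := prime_gt0 l_pr; lia.
have := @padicE l%:Z 1 l0 isT.
by rewrite divr1 -pmulrn => ->; rewrite /= logn_prime // eqxx logn1.
Qed.

Lemma vge_padic_frac (c : rat) : vge (padic l) 0 c -> ~~ (l %| `|denq c|)%N.
Proof.
rewrite /vge => /orP[/eqP->|]; first by rewrite dvdn1 neq_ltn prime_gt1 ?orbT.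
rewrite /padic => h; apply/negP => ld.
have : (0 < logn l `|denq c|)%N by rewrite logn_gt0 mem_primes l_pr absz_gt0 denq_neq0.
have : ~~ (l %| `|numq c|)%N.
  apply/negP => ln; have := coprime_num_den c; rewrite /coprime => /eqP g.
  by have := prime_gt1 l_pr; rewrite ltnNge dvdn_leq // -g dvdn_gcd ln.
move=> /negPf ln; have ln0 : logn l `|numq c| = 0%N by rewrite lognE ln !andbF.
by rewrite ln0 in h; lia.
Qed.

Lemma padic_int_unit (n : int) : ~~ (l %| `|n|)%N -> padic l n%:~R = 0.
Proof.
move=> ln; have [->|n0] := eqVneq n 0; first exact: dval0 padicP.
by rewrite -[n%:~R]divr1 (@padicE n 1) // logn1 lognE (negPf ln) !andbF.
Qed.

End Padic.

(** * Places of a number field above a rational prime; finiteness of poles *)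

Section PlacesAbove.
Variables (K : fieldExtType rat).
Implicit Types (p : prime_place K) (c : rat).

Lemma natK_neq0 (n : nat) : (0 < n)%N -> (n%:R : K) != 0.
Proof.
by move=> n0; rewrite -(rmorph_nat (in_alg K)) fmorph_eq0 pnatr_eq0 -lt0n.
Qed.

(** Bezout gives [a * l = b * n + 1] with [l] in the maximal ideal; hence [b * n] reduces to -1 and
    [n] is a unit. *)
Lemma place_nat_unit p (l n : nat) : 0 < p l%:R -> prime l -> ~~ (l %| n)%N ->
  n%:R != 0 :> K /\ p n%:R = 0.
Proof.
move=> pl lp ln; have pP := placeP p.
have cop : coprime l n by rewrite prime_coprime.
have [a b ab _] := egcdnP n (prime_gt0 lp).
move: cop; rewrite /coprime => /eqP cop; rewrite cop in ab.
have h : vge p 1 (1 + (b%:R * n%:R : K)).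
  rewrite -natrM addrC -(natrD _ _ 1%N) -ab natrM.
  apply: (vge_mul0 pP); first exact: vge_nat.
  by rewrite /vge; apply/orP; right.
have [n0 vn] : (b%:R * n%:R : K) != 0 /\ p (b%:R * n%:R) = 0.
  have -> : p (b%:R * n%:R) = p (- (b%:R * n%:R)) by rewrite (dvalN pP).
  rewrite -oppr_eq0; apply: (dval_add_gt pP (oner_neq0 K) (dval1 pP)).
  by rewrite -(vgeN pP) opprB opprK.
move: (n0); rewrite mulf_eq0 negb_or => /andP[b0 nn0]; split=> //.
move: vn; rewrite (dvalM pP) //.
have := vge_nat pP n; have := vge_nat pP b; rewrite !vgeP //; lia.
Qed.

Lemma ratA_denq c : (c%:A * `|denq c|%:R : K) = (numq c)%:~R.
Proof.
have -> : (`|denq c|%:R : K) = (denq c)%:~R.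
  by rewrite -[RHS](congr1 intr (gez0_abs (denq_ge0 c))).
have -> : ((denq c)%:~R : K) = in_alg K (denq c)%:~R by rewrite rmorph_int.
by rewrite -[X in X * _]/(in_alg K c) -rmorphM /= -numqE -[LHS]/(in_alg K _) rmorph_int.
Qed.

Lemma vge_place_padic p (l : nat) c : 0 < p l%:R -> prime l ->
  vge (padic l) 0 c -> vge p 0 (c%:A : K).
Proof.
move=> pl lp /(vge_padic_frac lp) /(place_nat_unit pl lp)[d0 vd].
have pP := placeP p.
have -> : (c%:A : K) = (numq c)%:~R * (`|denq c|%:R)^-1.
  by rewrite -ratA_denq mulfK.
apply: (vge_mul0 pP); first exact: vge_int.
by rewrite vgeP ?invr_eq0 // (dvalV pP) // vd.
Qed.

(** Weak approximation gives one element per place, a unit there and of positive valuation at the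
    other places of [ps]. These are independent over Q: dividing a relation by a coefficient of
    least l-adic valuation leaves one term a unit at its place and all others of positive valuation
    there. *)
Lemma size_places_above (l : nat) (ps : seq (prime_place K)) :
  prime l -> uniq ps -> {in ps, forall p, 0 < p l%:R} ->
  (size ps <= \dim {:K})%N.
Proof.
move=> lp ups hps.
have /choice[e eP] : forall p : prime_place K, exists z : K,
    p \in ps -> [/\ z != 0, p z = 0 & {in ps, forall q, q != p -> 0 < q z}].
  move=> p; have [pps|] := boolP (p \in ps); last by exists 0.
  have [z [z0 pz hz]] := @place_approx K p (rem p ps) ltac:(by rewrite mem_rem_uniqF).
  by exists z => _; split=> // q qps qp; apply: hz; rewrite mem_rem_uniq // inE qp.
pose es := [tuple of map e (in_tuple ps)].
have fes : free es.
  apply/freeP => k sk i; apply: contrapT => /eqP ki.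
  pose w j := padic l (k j).
  pose i0 := [arg min_(j < i | k j != 0) w j]%O.
  have [ki0 wmin] : k i0 != 0 /\ forall j, k j != 0 -> w i0 <= w j.
    by rewrite /i0; case: arg_minP.
  pose p := tnth (in_tuple ps) i0.
  have pps : p \in ps by exact: mem_tnth.
  have pP := placeP p; have [e0 pe he] := eP _ pps.
  have pE (j : 'I_(size ps)) : es`_j = e (tnth (in_tuple ps) j).
    by rewrite -tnth_nth tnth_map.
  have : vge p 1 (e p).
    have -> : e p = - \sum_(j | j != i0) (k j / k i0)%:A * es`_j.
      apply/eqP; rewrite -subr_eq0 opprK; apply/eqP.
      have -> : e p = (k i0 / k i0)%:A * es`_i0.
        by rewrite mulfV // scale1r mul1r pE.
      transitivity (\sum_(j < size ps) (k j / k i0)%:A * es`_j); first by rewrite [RHS](bigD1 i0).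
      transitivity ((k i0)^-1 *: \sum_(j < size ps) k j *: es`_j).
        rewrite scaler_sumr.
        by apply: eq_bigr => j _; rewrite -scalerAl mul1r scalerA [_^-1 * _]mulrC.
      by rewrite sk scaler0.
    rewrite (vgeN pP); apply: (vge_sum pP) => j ji.
    apply: (vge_mul0 pP).
      apply: (vge_place_padic (hps _ pps) lp).
      have [->|kj] := eqVneq (k j) 0; first by rewrite mul0r vge0.
      rewrite vgeP ?mulf_neq0 ?invr_eq0 // (dvalM (padicP lp)) ?invr_eq0 //.
      by rewrite (dvalV (padicP lp)) // subr_ge0 wmin.
    rewrite pE; set q := tnth _ j.
    have qps : q \in ps by exact: mem_tnth.
    have [q0 _ hq] := eP _ qps; rewrite vgeP //; apply: hq => //.
    apply: contra ji => /eqP pq; apply/eqP/val_inj/eqP => /=.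
    rewrite -(nth_uniq p (ltn_ord j) (ltn_ord i0) ups).
    apply/eqP; apply: etrans (esym (tnth_nth p (in_tuple ps) j)) _.
    exact: etrans (esym pq) (tnth_nth p (in_tuple ps) i0).
  by rewrite vgeP // pe.
have /eqP <- : size es == size ps by rewrite size_tuple.
by rewrite -(eqP fes) dimvS // subvf.
Qed.

Lemma finite_places_above (l : nat) : prime l ->
  finite_set [set p : prime_place K | 0 < p l%:R].
Proof.
move=> lp; apply: contrapT => /(infinite_set_fset (\dim {:K}).+1)[B Bsub].
rewrite ltnNge => /negP; apply.
apply: (size_places_above lp (fset_uniq B)) => p pB; exact: Bsub.
Qed.

Lemma place_nat_prime p (n : nat) : (0 < n)%N -> 0 < p n%:R ->
  exists2 l, l \in primes n & 0 < p l%:R.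
Proof.
have pP := placeP p.
elim/ltn_ind: n => n IH n0 pn; have [n1|n1] := leqP n 1.
  have n1' : n = 1%N by lia.
  by move: pn; rewrite n1' (dval1 pP).
have lp := pdiv_prime n1; have ln := pdiv_dvd n.
have [pl|pl] := ltrP 0 (p (pdiv n)%:R).
  by exists (pdiv n) => //; rewrite mem_primes lp n0 ln.
have q0 : (0 < n %/ pdiv n)%N by rewrite divn_gt0 ?pdiv_gt0 // pdiv_leq.
have [||l lq pl'] := IH (n %/ pdiv n)%N _ q0; last first.
  exists l => //; move: lq; rewrite !mem_primes n0 q0 => /andP[->] /= h.
  by rewrite (dvdn_trans h) // dvdn_div.
  move: pn; rewrite -{1}(divnK ln) natrM (dvalM pP) ?natK_neq0 ?pdiv_gt0 //.
  by lia.
by rewrite ltn_Pdiv // prime_gt1.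
Qed.

(** A place with a pole at [c] has a zero at its denominator, hence lies above one of the prime
    factors of the latter. *)
Lemma finite_places_lt0_rat c :
  finite_set [set p : prime_place K | p (c%:A : K) < 0].
Proof.
apply: (@sub_finite_set _ _
  (\bigcup_(l in [set` primes `|denq c|]) [set p : prime_place K | 0 < p l%:R])).
  move=> p /= pc; have pP := placeP p.
  have c0 : (c%:A : K) != 0 by apply: contraTneq pc => ->; rewrite (dval0 pP).
  have d0 : (`|denq c|%:R : K) != 0 by rewrite natK_neq0 // absz_gt0 denq_neq0.
  have dn : (0 < `|denq c|)%N by rewrite absz_gt0 denq_neq0.
  have [|l ld pl] := place_nat_prime (p := p) dn.
    have : vge p 0 (c%:A * `|denq c|%:R : K).
      rewrite ratA_denq; exact: vge_int.
    rewrite vgeP ?mulf_neq0 // (dvalM pP) // => h.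
    by rewrite -(ltrD2l (p c%:A)) addr0; exact: lt_le_trans pc h.
  by exists l.
apply: bigcup_finite; first exact: finite_seq.
by move=> l /=; rewrite mem_primes => /andP[lp _]; exact: finite_places_above.
Qed.

(** By integral closedness ([vge_root]) a pole of [x] is a pole of some coefficient of its minimal
    polynomial over Q. *)
Lemma finite_places_lt0 (x : K) : finite_set [set p : prime_place K | p x < 0].
Proof.
have /polyOver1P[q Dq] := minPolyOver 1 x.
apply: (@sub_finite_set _ _ (\bigcup_(i in `I_(size q))
   [set p : prime_place K | p ((q`_i)%:A : K) < 0])); last first.
  by apply: bigcup_finite => [|i _]; [exact: finite_II | exact: finite_places_lt0_rat].
move=> p /= px; apply: contrapT => h; have pP := placeP p.
suff : vge p 0 x.
  rewrite vgeP; first lia.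
  by apply: contraTneq px => ->; rewrite (dval0 pP).
apply: (vge_root pP (monic_minPoly 1 x) _ (root_minPoly 1 x)) => i.
rewrite Dq coef_map /=; have [iq|iq] := ltnP i (size q); last first.
  by rewrite nth_default // scale0r vge0.
rewrite /vge; apply/orP; right; rewrite leNgt; apply/negP => pi.
by apply: h; exists i.
Qed.

End PlacesAbove.

(** * Existence of places *)

Section Hensel.
Variables (F : fieldType) (v : F -> int) (L : completion v).
Let w : L -> int := @compl_val F v L.
Let wP : discrete_valuation w := compl_valP L.

Lemma vge_all_eq0 (x : L) : (forall k : nat, vge w k x) -> x = 0.
Proof.
move=> h; apply: contrapT => /eqP x0.
have := h (`|w x|.+1)%N; rewrite vgeP //; lia.
Qed.

(** Induction along Horner's scheme keeps the second-order remainder integral without dividing by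
    factorials. *)
Lemma vge_taylor (q : {poly L}) (x h : L) : (forall i, vge w 0 q`_i) ->
  vge w 0 x -> vge w 0 h ->
  exists2 r, vge w 0 r & q.[x + h] = q.[x] + h * q^`().[x] + h ^+ 2 * r.
Proof.
move=> + hx hh; elim/poly_ind: q => [|q c IH] hq.
  by exists 0; rewrite ?vge0 // deriv0 !horner0; ring.
have hq' i : vge w 0 q`_i.
  by have := hq i.+1; rewrite coefD coefMX coefC /= addr0.
have [r hr e] := IH hq'; exists (r * (x + h) + q^`().[x]).
  apply: (vgeD wP); first by apply: (vge_mul0 wP) => //; exact: (vgeD wP).
  apply: vge_horner => // i; rewrite coef_deriv -mulr_natr.
  by apply: (vge_mul0 wP) => //; exact: vge_nat.
rewrite derivD derivM derivX derivC !hornerE /= e; ring.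
Qed.

(** Newton iteration with the slope frozen at [d]: each step gains one unit of valuation, which
    already makes the sequence Cauchy. *)
Lemma hensel (q : {poly L}) (n : L) : (forall i, vge w 0 q`_i) -> vge w 0 n ->
  vge w 1 q.[n] -> q^`().[n] != 0 -> w q^`().[n] = 0 ->
  exists2 y, vge w 0 y & root q y.
Proof.
move=> hq hn qn d0 wd; set d := q^`().[n] in d0 wd.
have hq' i : vge w 0 q^`()`_i.
  by rewrite coef_deriv -mulr_natr; apply: (vge_mul0 wP) => //; exact: vge_nat.
have hdV : vge w 0 d^-1 by rewrite vgeP ?invr_eq0 // (dvalV wP) // wd.
pose u := fix u k := if k is k'.+1 then u k' - q.[u k'] / d else n.
have uP (k : nat) : [/\ vge w 0 (u k), vge w 1 (u k - n) & vge w (k.+1)%:Z q.[u k]].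
  elim: k => [|k [u0 u1 u2]] /=; first by rewrite subrr vge0.
  have h1 : vge w (k.+1)%:Z (- (q.[u k] / d)).
    by rewrite (vgeN wP) mulrC; exact: (vge_mul0 wP).
  have h0 : vge w 0 (- (q.[u k] / d)) by apply: vge_le h1.
  have h2 : vge w 1 (- (q.[u k] / d)) by apply: vge_le h1.
  split; first exact: (vgeD wP).
    by rewrite addrAC; exact: (vgeD wP).
  have [r hr ->] := vge_taylor hq u0 h0.
  (* Both summands of the second factor have positive valuation: the slope at [u k] is congruent to
     [d] because [u k] is congruent to [n], and [q.[u k]] is small by induction. *)
  have -> : q.[u k] + - (q.[u k] / d) * q^`().[u k] + (- (q.[u k] / d)) ^+ 2 * r =
    q.[u k] * (d^-1 * (d - q^`().[u k]) + q.[u k] * (d^-1 * (d^-1 * r))).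
    by field.
  rewrite -addn1 PoszD; apply: (vgeM wP) => //; apply: (vgeD wP).
    apply: (vge_mul0 wP) => //; rewrite -(vgeN wP) opprB.
    exact: (vge_horner_sub wP).
  rewrite mulrC; apply: (vge_mul0 wP); last by apply: vge_le u2.
  by do 2!apply: (vge_mul0 wP) => //.
have ud (k m : nat) : (k <= m)%N -> vge w k (u m - u k).
  elim: m => [|m IH]; first by rewrite leqn0 => /eqP ->; rewrite subrr vge0.
  rewrite leq_eqVlt => /predU1P[->|km]; first by rewrite subrr vge0.
  rewrite /= addrAC; apply: (vgeD wP); first exact: IH.
  have [_ _ h] := uP m; rewrite (vgeN wP) mulrC; apply: (vge_mul0 wP) => //.
  by apply: vge_le h; lia.
have [|y hy] := @compl_complete F v L u.
  move=> k; exists `|k|%N => m l km kl.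
  apply: (@vge_le _ _ `|k|%N); first lia.
  have -> : u m - u l = (u m - u `|k|%N) - (u l - u `|k|%N) by ring.
  by apply: (vgeB wP); exact: ud.
have y0 : vge w 0 y.
  have [m hm] := hy 0; rewrite -(subKr (u m) y); apply: (vgeB wP); last exact: hm.
  by have [] := uP m.
exists y => //; apply/rootP/vge_all_eq0 => k.
have [m hm] := hy k; rewrite -(subKr q.[u (maxn m k)] q.[y]).
have [um _ qm] := uP (maxn m k).
apply: (vgeB wP); first by apply: vge_le qm; lia.
apply: (vge_horner_sub wP) => //; apply: hm; exact: leq_maxl.
Qed.

End Hensel.

(** Schur's argument: with c = g(0) nonzero and x = c M t, one has g(x) = c z with z congruent to 1
    modulo M, so a prime dividing z is prime to M. If g(0) = 0, any prime beyond |M| works at 0. *)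
Lemma schur_prime (g : {poly int}) (M : int) : (1 < size g)%N -> M != 0 ->
  exists l (n : int), [/\ prime l, ~~ (l %| `|M|)%N & (l %| g.[n])%Z].
Proof.
move=> sg M0; have [c0|c0] := eqVneq g.[0] 0.
  have [l lM lp] := prime_above `|M|%N; exists l, 0; split=> //; last by rewrite c0.
  by apply/negP => /dvdn_leq; rewrite absz_gt0 M0 => /(_ isT); lia.
set c := g.[0] in c0.
have [h gE] : exists h, g = h * 'X + c%:P.
  rewrite /c; elim/poly_ind: (g) => [|h d _]; first by exists 0; rewrite horner0 mul0r addr0.
  by exists h; rewrite hornerMXaddC mulr0 add0r.
(* [P] vanishes at [x] exactly when z is 1 or -1, which excludes only finitely many t. *)
pose P := (g - c%:P) * (g + c%:P).
have sgc (d : int) : (1 < size (g + d%:P)%R)%N.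
  by rewrite size_polyDl // (leq_ltn_trans (size_polyC_leq1 _)).
have P0 : P != 0.
  by rewrite mulf_neq0 // -size_poly_gt0 ?(ltn_trans _ (sgc _)) // -polyCN (ltn_trans _ (sgc _)).
have cM0 : c * M != 0 by rewrite mulf_neq0.
have [t ht] : exists t : nat, ~~ root P (c * M * t%:Z).
  apply: contrapT => /forallNP hP.
  have := @max_poly_roots _ P [seq c * M * t%:Z | t <- iota 0 (size P)] P0.
  rewrite size_map size_iota ltnn; move=> H; apply: notF; apply: H.
    by apply/allP => _ /mapP[t _ ->]; apply: contrapT => /negP; exact: hP.
  rewrite map_inj_uniq ?iota_uniq // => a b /(mulfI cM0); lia.
set x := c * M * t%:Z in ht.
pose z := 1 + M * t%:Z * h.[x].
have gx : g.[x] = c * z by rewrite gE hornerMXaddC /z /x; ring.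
have [z1 zN1] : z != 1 /\ z != -1.
  split; apply: contraNneq ht => e; rewrite /root /P hornerM hornerD hornerN hornerD hornerC.
    by rewrite gx e mulr1 subrr mul0r.
  by rewrite gx e mulrN1 addNr mulr0.
have zN : `|z|%N != 1%N by lia.
have [l lp lz] : exists2 l, prime l & (l %| `|z|)%N.
  (* The value z = 0 remains possible, and any prime divides it. *)
  have [->|z0] := eqVneq `|z|%N 0%N; first by exists 2%N.
  exists (pdiv `|z|); last exact: pdiv_dvd.
  by apply: pdiv_prime; lia.
exists l, x; split=> //; last by rewrite gx dvdz_mull // dvdzE.
apply/negP => lM; have := prime_gt1 lp; suff : (l %| 1)%N by rewrite dvdn1 => /eqP ->.
have -> : 1%N = `|(z - M * (t%:Z * h.[x]))%R|%N by rewrite /z mulrA addrK.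
have lz' : (l %| z)%Z by rewrite dvdzE.
have lM' : (l %| M)%Z by rewrite dvdzE.
by have := rpredB lz' (dvdz_mulr (t%:Z * h.[x]) lM'); rewrite dvdzE.
Qed.

Lemma padic_intr_gt0 (l : nat) (a : int) : prime l -> (l %| a)%Z ->
  vge (padic l) 1 a%:~R.
Proof.
move=> lp; have [->|a0] := eqVneq a 0; first by rewrite vge0.
rewrite dvdzE /= => la; rewrite vgeP ?intr_eq0 // -[a%:~R]divr1.
rewrite (@padicE l lp a 1) // logn1 subr0 lez_nat logn_gt0 mem_primes lp la.
by rewrite absz_gt0 a0.
Qed.

Lemma vge_padic_denq (l : nat) (c : rat) : prime l -> ~~ (l %| `|denq c|)%N ->
  vge (padic l) 0 c.
Proof.
move=> lp lc; have [->|c0] := eqVneq c 0; first exact: vge0.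
by rewrite vgeP // /padic [logn l `|denq c|]lognE (negPf lc) !andbF subr0.
Qed.

Lemma exists_prime_root (q : {poly rat}) (cs : seq rat) : (1 < size q)%N ->
  exists l (n : int), [/\ prime l, {in cs, forall c, vge (padic l) 0 c}
    & vge (padic l) 1 q.[n%:~R]].
Proof.
move=> sq; have [g [a a0 qE]] := rat_poly_scale q.
(* A prime not dividing [M] divides neither the common denominator [a] of [q] nor the denominators
   of [cs]. *)
pose M := a * \prod_(c <- cs) denq c.
have M0 : M != 0.
  by rewrite mulf_neq0 // prodf_seq_neq0; apply/allP => c _; exact: denq_neq0.
have sg : (1 < size g)%N.
  move: sq; rewrite qE size_scale ?invr_eq0 ?intr_eq0 //.
  by rewrite size_map_inj_poly ?rmorph0 //; exact: intr_inj.
have [l [n [lp lM ln]]] := schur_prime sg M0; exists l, n; split=> //.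
  move=> c cs_c; apply: vge_padic_denq => //; apply: contra lM => lc.
  rewrite /M abszM dvdn_mull // (big_rem c) //= abszM dvdn_mulr //.
have la : ~~ (l %| `|a|)%N by apply: contra lM => la; rewrite /M abszM dvdn_mulr.
rewrite qE hornerZ horner_map /=; apply: (vge_mul0 (padicP lp)); last exact: padic_intr_gt0.
by rewrite vgeP ?invr_eq0 ?intr_eq0 // (dvalV (padicP lp)) ?intr_eq0 // padic_int_unit.
Qed.

(** Elements of K are polynomials in [theta], which can be evaluated at [y] instead; the choice of
    polynomial is immaterial because those vanishing at [theta] are multiples of [q]. *)
Lemma embed_of_root (F : fieldType) (K : fieldExtType F) (L : fieldType)
    (i : {rmorphism F -> L}) (theta : K) (q : {poly F}) (y : L) :
  <<1%VS; theta>>%VS = fullv -> map_poly (in_alg K) q = minPoly 1 theta ->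
  root (map_poly i q) y ->
  exists phi : {rmorphism K -> L}, forall p : {poly F},
    phi (map_poly (in_alg K) p).[theta] = (map_poly i p).[y].
Proof.
move=> gen qE qy.
have /choice[P hP] : forall x : K, exists p : {poly F}, x = (map_poly (in_alg K) p).[theta].
  move=> x; have : x \in <<1%VS; theta>>%VS by rewrite gen memvf.
  by case/Fadjoin_polyP => _ /polyOver1P[p ->] ->; exists p.
pose phi x := (map_poly i (P x)).[y].
have phiE p : phi (map_poly (in_alg K) p).[theta] = (map_poly i p).[y].
  apply/eqP; rewrite -subr_eq0 -hornerN -hornerD -rmorphN -rmorphD /=.
  set r := P _ - p; have : minPoly 1 theta %| map_poly (in_alg K) r.
    apply: minPoly_dvdp; first by apply/polyOver1P; exists r.
    by apply/rootP; rewrite rmorphB hornerD hornerN -hP subrr.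
  rewrite -qE dvdp_map => /dvdpP[s ->].
  by rewrite rmorphM hornerM (rootP qy) mulr0.
have phiB : zmod_morphism phi.
  move=> x z; rewrite {1}(hP x) {1}(hP z) -hornerN -hornerD -rmorphN -rmorphD /= phiE.
  by rewrite rmorphD rmorphN hornerD hornerN.
have phiM : monoid_morphism phi.
  split=> [|x z].
    have e : (1 : K) = (map_poly (in_alg K) 1).[theta] by rewrite rmorph1 hornerC.
    by rewrite [in LHS]e phiE rmorph1 hornerC.
  rewrite {1}(hP x) {1}(hP z) -hornerM -rmorphM /= phiE.
  by rewrite rmorphM hornerM.
pose mz := GRing.isZmodMorphism.Build K L phi phiB.
pose mm := GRing.isMonoidMorphism.Build K L phi phiM.
pose Phi : {rmorphism K -> L} := HB.pack phi mz mm.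
by exists Phi.
Qed.

Lemma compl_emb_vge (F : fieldType) (v : F -> int) (L : completion v) k (c : F) :
  vge (@compl_val _ _ L) k (compl_emb L c) = vge v k c.
Proof. by rewrite /vge compl_embP fmorph_eq0. Qed.

(** The restricted valuation stays surjective because [l] has value 1. By density of Q in [L] every
    integral element is congruent to one of 0, ..., l-1, so the residue field is finite; this
    matters since [fset_set] of an infinite set is empty. *)
Lemma place_of_completion (K : fieldExtType rat) (l : nat)
    (L : completion (padic l)) (phi : {rmorphism K -> L}) : prime l ->
  exists2 p : prime_place K, forall k x, vge p k x = vge (@compl_val _ _ L) k (phi x)
    & (1 < place_norm p)%N.
Proof.
move=> lp; set w := @compl_val _ _ L; have wP : discrete_valuation w := compl_valP L.
have vP : discrete_valuation (fun x => w (phi x)).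
  split.
  - by rewrite rmorph0 (dval0 wP).
  - by move=> x y x0 y0; rewrite rmorphM (dvalM wP) ?fmorph_eq0.
  - by move=> x y x0 y0 s0; rewrite rmorphD (dvalD wP) -?rmorphD ?fmorph_eq0.
  - exists l%:R; first by rewrite natK_neq0 ?prime_gt0.
    by rewrite rmorph_nat -(rmorph_nat (compl_emb L)) /w compl_embP padic_nat.
pose p := PrimePlace (asboolT vP).
have pE k x : vge p k x = vge w k (phi x) by rewrite /vge fmorph_eq0.
have pP := placeP p.
exists p => //; rewrite /place_norm; set A := [set _ | _ in _].
have residue x : vge p 0 x -> exists2 i, (i < l)%N & vge p 1 (x - i%:R).
  rewrite pE => hx; have [c hc] := @compl_dense _ _ L (phi x) 1.
  have c0 : vge (padic l) 0 c.
    rewrite -(compl_emb_vge L) -(subKr (phi x) (compl_emb L c)).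
    by apply: (vgeB wP) => //; exact: vge_le hc.
  have lc := vge_padic_frac lp c0.
  have /coprimezP[[s t] /= st] : coprimez l (denq c).
    by rewrite coprimezE /= prime_coprime.
  have l0 : l%:Z != 0 by have := prime_gt0 lp; lia.
  (* [t] inverts the denominator modulo [l], so [i] is the residue of [c]. *)
  pose i := `|(numq c * t %% l)%Z|%N.
  have iE : i%:Z = (numq c * t %% l)%Z by rewrite /i gez0_abs // modz_ge0.
  exists i; first by rewrite -ltz_nat iE ltz_pmod //; have := prime_gt0 lp; lia.
  rewrite pE rmorphB rmorph_nat -(subrKA (compl_emb L c)); apply: (vgeD wP) => //.
  rewrite -(rmorph_nat (compl_emb L)) -rmorphB compl_emb_vge.
  have d0 : ((denq c)%:~R : rat) != 0 by rewrite intr_eq0 denq_neq0.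
  have -> : c - i%:R = ((denq c)%:~R)^-1 * (numq c - i%:Z * denq c)%:~R.
    by rewrite rmorphB rmorphM /= numqE -pmulrn; field.
  apply: (vge_mul0 (padicP lp)).
    by rewrite vgeP ?invr_eq0 // (dvalV (padicP lp)) // padic_int_unit.
  apply: padic_intr_gt0 => //.
  have -> : numq c - i%:Z * denq c =
      l%:Z * (numq c * s + (numq c * t %/ l)%Z * denq c).
    rewrite iE; have := divz_eq (numq c * t) l; move: (_ %/ _)%Z (_ %% _)%Z => a b e.
    have -> : b = numq c * t - a * l by rewrite e; ring.
    by rewrite -[X in X - _ = _]mulr1 -st; ring.
  exact: dvdz_mulr.
have Afin : finite_set A.
  apply: (@sub_finite_set _ _ ((fun i : nat => [set y | vge p 1 (y - i%:R)]) @` `I_l)).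
    move=> _ [x /= /residue[i il xi] <-]; exists i => //.
    apply/funext => y; apply/propext; split => /= h.
      by rewrite -(subrKA i%:R) -(opprB x); apply: (vgeB pP).
    by rewrite -(subrKA x); apply: (vgeD pP).
  by apply: finite_image; exact: finite_II.
pose C x := [set y | vge p 1 (y - x)].
have CA x : vge p 0 x -> C x \in fset_set A.
  by move=> x0; rewrite in_fset_set //; apply/mem_set; exists x.
have C01 : C 0 != C 1.
  apply/eqP => e; have : C 0 0 by rewrite /C /= subr0 vge0.
  by rewrite e /C /= sub0r (vgeN pP) vgeP ?oner_neq0 // (dval1 pP).
have <- : #|` [fset C 0; C 1]|%fset = 2%N by rewrite cardfs2 C01.
apply: fsubset_leq_card; apply/fsubsetP => B; rewrite !inE => /orP[/eqP->|/eqP->].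
  by apply: CA; exact: vge0.
by apply: CA; exact: vge1.
Qed.

(** With [q] the minimal polynomial of a primitive element, a Bezout identity u1 q + u2 q' = b that
    is integral at [l] makes any root of [q] modulo [l] simple, as Hensel's lemma requires. *)
Lemma exists_place (K : fieldExtType rat) (xs : seq K) :
  exists2 p : prime_place K, {in xs, forall x, vge p 0 x} & (1 < place_norm p)%N.
Proof.
have charK : [pchar K] =i pred0.
  move=> l; apply/negP; rewrite inE => /andP[lp].
  by rewrite (negPf (natK_neq0 _ (prime_gt0 lp))).
pose theta := separable_generator 1 {:K}.
have gen : <<1%VS; theta>>%VS = fullv.
  apply/esym/eq_adjoin_separable_generator; last exact: sub1v.
  by apply/separableP => z _; exact: (pcharf0_separable 1 charK).
have /polyOver1P[q /esym qE] := minPolyOver 1 theta.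
have sepq : coprimep q q^`().
  have := pcharf0_separable 1 charK theta.
  by rewrite /separable_element -qE separable_map unlock.
have /Bezout_coprimepP[[u1 u2] /= /eqp_size] := sepq.
set B := _ + _; rewrite size_poly1 => /eqP/size_poly1P[b b0 BE].
have sq : (1 < size q)%N.
  rewrite -(size_map_poly (in_alg K)) qE.
  exact: root_size_gt1 (monic_neq0 (monic_minPoly 1 theta)) (root_minPoly 1 theta).
have /choice[P hP] : forall x : K, exists p : {poly rat}, x = (map_poly (in_alg K) p).[theta].
  move=> x; have : x \in <<1%VS; theta>>%VS by rewrite gen memvf.
  by case/Fadjoin_polyP => _ /polyOver1P[p ->] ->; exists p.
(* Integrality of [b^-1] lets the Bezout identity be rescaled to 1; the polynomials [P x] express
   [xs] in [theta], so integral coefficients give integral elements. *)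
pose cs : seq rat := [:: b^-1] ++ q ++ u1 ++ u2 ++ flatten [seq polyseq (P x) | x <- xs].
have [l [n [lp csP qn]]] := exists_prime_root cs sq.
have vP := padicP lp.
have coefs (p : {poly rat}) : {subset (p : seq rat) <= cs} -> forall i, vge (padic l) 0 p`_i.
  move=> sub i; have [ip|ip] := ltnP i (size p); last by rewrite nth_default // vge0.
  by apply/csP/sub/mem_nth.
have qI : forall i, vge (padic l) 0 q`_i.
  by apply: coefs => c cq; rewrite !mem_cat cq !orbT.
have nI : vge (padic l) 0 n%:~R by exact: vge_int.
pose d := q^`().[n%:~R].
have dI : vge (padic l) 0 d.
  apply: vge_horner => // i; rewrite coef_deriv -mulr_natr.
  by apply: (vge_mul0 vP) => //; exact: vge_nat.
(* Otherwise the rescaled Bezout identity at [n] would give 1 a positive valuation. *)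
have d1 : ~~ vge (padic l) 1 d.
  apply/negP => d1; have : vge (padic l) 1 (b^-1 * B.[n%:~R]).
    apply: (vge_mul0 vP); first by apply: csP; rewrite inE eqxx.
    rewrite /B hornerD !hornerM; apply: (vgeD vP); apply: (vge_mul0 vP) => //.
      by apply: vge_horner => //; apply: coefs => c cu; rewrite !mem_cat cu !orbT.
    by apply: vge_horner => //; apply: coefs => c cu; rewrite !mem_cat cu !orbT.
  by rewrite BE hornerC mulVf // vgeP // (dval1 vP).
have d0 : d != 0 by apply: contraNneq d1 => ->; exact: vge0.
have vd : padic l d = 0 by move: d1 dI; rewrite !vgeP //; lia.
have [L] := completion_exists vP; pose e := compl_emb L.
have wP := compl_valP L.
have eI (p : {poly rat}) : (forall i, vge (padic l) 0 p`_i) ->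
    forall i, vge (@compl_val _ _ L) 0 (map_poly e p)`_i.
  by move=> pI i; rewrite coef_map compl_emb_vge.
have [||||y yI qy] := @hensel _ _ L (map_poly e q) (e n%:~R) (eI _ qI).
- by rewrite compl_emb_vge.
- by rewrite horner_map compl_emb_vge.
- by rewrite deriv_map horner_map fmorph_eq0.
- by rewrite deriv_map horner_map compl_embP.
have [phi phiE] := embed_of_root gen qE qy.
have [p pE pn] := place_of_completion phi lp.
exists p => // x xxs; rewrite pE (hP x) phiE.
apply: (vge_horner wP) => //; apply: eI; apply: coefs => c cx.
rewrite !mem_cat; apply/orP; right; apply/orP; right; apply/orP; right; apply/orP; right.
by apply/flattenP; exists (P x : seq rat) => //; apply/mapP; exists x.
Qed.

(** * Polynomial maps and their extensions to projective space *)

Local Notation "p .-homog" := (mpoly.ishomog1 p mpoly.mdeg)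
  (at level 1, format "p .-homog").
Local Notation "''x_' i" := (mpoly.mpolyX _ (mpoly.mnm1 i))
  (at level 8, i at level 2, format "''x_' i").
Local Notation msize := (mpoly.mmeasure mpoly.mdeg).

Lemma mpoly_rmorph_ext (n : nat) (R : fieldType) (S : comNzRingType)
    (u1 u2 : {rmorphism mpoly n R -> S}) :
  (forall c, u1 (mpoly.mpolyC n c) = u2 (mpoly.mpolyC n c)) ->
  (forall i : 'I_n, u1 'x_i = u2 'x_i) -> u1 =1 u2.
Proof.
move=> hC hX p; rewrite (mpoly.mpolyE p) !rmorph_sum; apply: eq_bigr => m _.
rewrite -mpoly.mul_mpolyC !rmorphM hC mpoly.mpolyXE_id !rmorph_prod; congr (_ * _).
by apply: eq_bigr => i _; rewrite !rmorphXn hX.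
Qed.

Section Composition.
Variables (K : fieldType).

Lemma comp_mpoly_X (n k : nat) (g : n.-tuple (mpoly k K)) (i : 'I_n) :
  mpoly.comp_mpoly g 'x_i = tnth g i.
Proof. by rewrite mpoly.comp_mpolyXU -tnth_nth. Qed.

Lemma comp_mpolyA (n k l : nat) (g : n.-tuple (mpoly k K)) (h : k.-tuple (mpoly l K))
    (p : mpoly n K) :
  mpoly.comp_mpoly h (mpoly.comp_mpoly g p) =
  mpoly.comp_mpoly [tuple mpoly.comp_mpoly h (tnth g i) | i < n] p.
Proof.
pose u1 : {rmorphism mpoly n K -> mpoly l K} := mpoly.comp_mpoly h \o mpoly.comp_mpoly g.
apply: (mpoly_rmorph_ext (u1 := u1)) => [c|i] /=.
  by rewrite !mpoly.comp_mpolyC.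
by rewrite !comp_mpoly_X tnth_mktuple.
Qed.

(** [msize] is the degree plus one, and 0 for the zero polynomial; bounds of the form [d.+1] treat
    both cases uniformly. *)
Lemma msizeM_leS (n : nat) (p q : mpoly n K) (a b : nat) :
  (msize p <= a.+1)%N -> (msize q <= b.+1)%N -> (msize (p * q)%R <= (a + b).+1)%N.
Proof.
have [->|p0] := eqVneq p 0; first by rewrite mul0r mpoly.mmeasure0.
have [->|q0] := eqVneq q 0; first by rewrite mulr0 mpoly.mmeasure0.
move=> pa qb; rewrite mpoly.msizeM // -subn1 leq_subLR add1n.
by apply: leq_trans (leq_add pa qb) _; rewrite addSn addnS.
Qed.

Lemma msize_sum_le (n : nat) (I : eqType) (r : seq I) (E : I -> mpoly n K) (d : nat) :
  (forall i, i \in r -> (msize (E i) <= d)%N) -> (msize (\sum_(i <- r) E i)%R <= d)%N.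
Proof.
move=> h; apply: leq_trans (mpoly.mmeasure_sum _ _ _ _) _.
by apply/bigmax_leqP_seq => i ir _; exact: h.
Qed.

Lemma msize_prod_exp (n k : nat) (g : 'I_k -> mpoly n K) (e : 'I_k -> nat) (d : nat) :
  (forall i, (msize (g i) <= d.+1)%N) ->
  (msize (\prod_i g i ^+ e i)%R <= (\sum_i e i * d).+1)%N.
Proof.
have m1 : (msize (1 : mpoly n K) <= 1)%N by rewrite -mpoly.mpolyC1 mpoly.mmeasureC oner_neq0.
move=> h; elim/big_rec2: _ => // i a p _ IH; apply: msizeM_leS => //.
elim: (e i) => [|j IHj]; first by rewrite expr0.
by rewrite exprS mulSn; apply: msizeM_leS.
Qed.

Lemma msize_comp (n k : nat) (g : n.-tuple (mpoly k K)) (p : mpoly n K) (a b : nat) :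
  (msize p <= a.+1)%N -> (forall i, (msize (tnth g i) <= b.+1)%N) ->
  (msize (mpoly.comp_mpoly g p) <= (a * b).+1)%N.
Proof.
move=> pa gb; rewrite mpoly.comp_mpolyE; apply: msize_sum_le => m mp.
rewrite -mpoly.mul_mpolyC -[(a * b)%N]add0n; apply: msizeM_leS.
  by rewrite mpoly.mmeasureC; case: eqP.
apply: leq_trans (msize_prod_exp _ gb) _; rewrite ltnS -big_distrl leq_mul2r /=.
by rewrite -mpoly.mdegE -ltnS (leq_trans (mpoly.msize_mdeg_lt mp) pa) orbT.
Qed.

Lemma dhomog_sum (n d : nat) (I : eqType) (r : seq I) (E : I -> mpoly n K) :
  (forall i, i \in r -> E i \is d.-homog) -> \sum_(i <- r) E i \is d.-homog.
Proof. by move=> h; rewrite big_seq; apply: rpred_sum. Qed.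

Lemma dhomog_prod_exp (n k : nat) (g : 'I_k -> mpoly n K) (e : 'I_k -> nat) (d : nat) :
  (forall i, g i \is d.-homog) ->
  \prod_i g i ^+ e i \is (\sum_i d * e i).-homog.
Proof.
move=> h; elim/big_rec2: _ => [|i a p _ IH]; first exact: mpoly.dhomog1.
by apply: mpoly.dhomogM => //; exact: mpoly.dhomogMn.
Qed.

Lemma dhomog_comp (n k : nat) (g : n.-tuple (mpoly k K)) (p : mpoly n K) (d1 d2 : nat) :
  p \is d1.-homog -> (forall i, tnth g i \is d2.-homog) ->
  mpoly.comp_mpoly g p \is (d2 * d1).-homog.
Proof.
move=> /mpoly.dhomogP pd gd; rewrite mpoly.comp_mpolyE; apply: dhomog_sum => m mp.
have -> : d1 = (\sum_i m i)%N by rewrite -(pd m mp); exact: mpoly.mdegE.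
by apply: rpredZ; rewrite big_distrr; exact: dhomog_prod_exp.
Qed.

Lemma meval_dhomog (n d : nat) (p : mpoly n K) (c : K) (x y : 'I_n -> K) :
  p \is d.-homog -> (forall i, y i = c * x i) ->
  mpoly.meval y p = c ^+ d * mpoly.meval x p.
Proof.
move=> /mpoly.dhomogP pd yE; rewrite !mpoly.mevalE mulr_sumr [LHS]big_seq [RHS]big_seq.
apply: eq_bigr => m mp; rewrite mulrCA; congr (_ * _).
have -> : d = (\sum_i m i)%N by rewrite -(pd m mp); exact: mpoly.mdegE.
rewrite -prodrXr -big_split /=; apply: eq_bigr => i _.
by rewrite yE exprMn.
Qed.

Lemma dhomog_Xn (n k : nat) (i : 'I_n) : ('x_i : mpoly n K) ^+ k \is k.-homog.
Proof.
have X1 : ('x_i : mpoly n K) \is 1.-homog by rewrite mpoly.dhomogX /= mpoly.mdeg1.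
by have := mpoly.dhomogMn k X1; rewrite mul1n.
Qed.

End Composition.

(** * Polynomial maps: degrees of iterates, homogenisation and dominance *)

Section Maps.
Variables (K : fieldType) (N : nat).
Implicit Types (f g h : N.-tuple (mpoly N K)) (p : mpoly N K).

Lemma affine_degreeP f d :
  reflect (forall i, (msize (tnth f i) <= d.+1)%N) (affine_degree f <= d)%N.
Proof.
apply: (iffP (bigmax_leqP _ _ _)) => h i; first by have := h i isT; lia.
by move=> _; have := h i; lia.
Qed.

Lemma affine_compA f g h : affine_comp h (affine_comp g f) = affine_comp (affine_comp h g) f.
Proof.
apply: eq_from_tnth => i; rewrite !tnth_mktuple comp_mpolyA.
by congr mpoly.comp_mpoly.
Qed.

Lemma affine_iterD f a b :
  affine_iter f (a + b) = affine_comp (affine_iter f a) (affine_iter f b).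
Proof.
elim: a => [|a IH]; last by rewrite addSn /affine_iter !iterS -!/(affine_iter _ _) IH affine_compA.
by apply: eq_from_tnth => i; rewrite !tnth_mktuple comp_mpoly_X.
Qed.

Lemma affine_degree_comp f g :
  (affine_degree (affine_comp g f) <= affine_degree g * affine_degree f)%N.
Proof.
apply/affine_degreeP => i; rewrite tnth_mktuple.
by apply: msize_comp; [|move=> j]; apply/affine_degreeP.
Qed.

Lemma affine_degree_iterM f a k :
  (affine_degree (affine_iter f (a * k.+1)) <= affine_degree (affine_iter f a) ^ k.+1)%N.
Proof.
elim: k => [|k IH]; first by rewrite muln1 expn1.
rewrite mulnS affine_iterD expnS; apply: leq_trans (affine_degree_comp _ _) _.
exact: leq_mul.
Qed.

Lemma affine_eval_comp f g P : affine_eval (affine_comp g f) P = affine_eval g (affine_eval f P).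
Proof.
apply/rowP => i; rewrite !mxE tnth_mktuple mpoly.comp_mpoly_meval.
by apply: mpoly.meval_eq => j; rewrite mxE.
Qed.

Lemma affine_eval_iter f n P : affine_eval (affine_iter f n) P = iter n (affine_eval f) P.
Proof.
elim: n => [|n IH] /=; last by rewrite affine_eval_comp IH.
by apply/rowP => i; rewrite mxE tnth_mktuple mpoly.mevalXU.
Qed.

Lemma homogenize_dhomog p d : (msize p <= d.+1)%N -> homogenize d p \is d.-homog.
Proof.
move=> pd; apply: dhomog_sum => m mp; apply: rpredZ.
have md : (mpoly.mdeg m <= d)%N by rewrite -ltnS (leq_trans (mpoly.msize_mdeg_lt mp)).
rewrite -{2}(subnK md); apply: mpoly.dhomogM.
  exact: dhomog_Xn.
rewrite mpoly.mdegE (eq_bigr (fun i => 1 * m i)%N) => [|i _]; last by rewrite mul1n.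
by apply: dhomog_prod_exp => i; exact: dhomog_Xn 1%N _.
Qed.

Lemma projective_extension0 f : tnth (projective_extension f) ord0 = 'x_ord0 ^+ affine_degree f.
Proof. by rewrite tnth_mktuple unlift_none. Qed.

Lemma projective_extensionS f i :
  tnth (projective_extension f) (fintype.lift ord0 i) = homogenize (affine_degree f) (tnth f i).
Proof. by rewrite tnth_mktuple liftK. Qed.

Lemma projective_extension_dhomog f j :
  tnth (projective_extension f) j \is (affine_degree f).-homog.
Proof.
case: (unliftP ord0 j) => [i|] ->.
  by rewrite projective_extensionS; apply/homogenize_dhomog/affine_degreeP.
by rewrite projective_extension0; exact: dhomog_Xn.
Qed.

Lemma rmorph_homogenize (S : comNzRingType) (u : {rmorphism mpoly N.+1 K -> S}) d p :
  u (homogenize d p) = \sum_(m <- mpoly.msupp p) u (mpoly.mpolyC _ (mpoly.mcoeff m p)) *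
    (u 'x_ord0 ^+ (d - mpoly.mdeg m) * \prod_(i < N) u 'x_(fintype.lift ord0 i) ^+ m i).
Proof.
rewrite rmorph_sum; apply: eq_bigr => m _.
rewrite -mpoly.mul_mpolyC !rmorphM rmorphXn rmorph_prod; congr (_ * (_ * _)).
by apply: eq_bigr => i _; rewrite rmorphXn.
Qed.

Lemma meval_homogenize d p (x : 'I_N.+1 -> K) :
  mpoly.meval x (homogenize d p) = \sum_(m <- mpoly.msupp p) mpoly.mcoeff m p *
    (x ord0 ^+ (d - mpoly.mdeg m) * \prod_(i < N) x (fintype.lift ord0 i) ^+ m i).
Proof.
rewrite (rmorph_homogenize (mpoly.meval x)); apply: eq_bigr => m _ /=.
rewrite mpoly.mevalC !mpoly.mevalXU; congr (_ * (_ * _)).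
by apply: eq_bigr => i _; rewrite mpoly.mevalXU.
Qed.

Lemma projective_eval_affine f P :
  projective_eval (projective_extension f) (affine_point P) = affine_point (affine_eval f P).
Proof.
apply/rowP => j; rewrite !mxE; case: (unliftP ord0 j) => [i|] ->.
  rewrite projective_extensionS meval_homogenize [RHS]mxE mpoly.mevalE; apply: eq_bigr => m _.
  rewrite mxE unlift_none expr1n mul1r; congr (_ * _); apply: eq_bigr => k _.
  by rewrite mxE liftK.
by rewrite projective_extension0 rmorphXn /= mpoly.mevalXU mxE unlift_none expr1n.
Qed.

Definition dehomogenize (A : mpoly N.+1 K) : mpoly N K :=
  mpoly.comp_mpoly [tuple (if unlift ord0 j is Some i then 'x_i else 1) | j < N.+1] A.

Lemma dehomogenize_homogenize d p : dehomogenize (homogenize d p) = p.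
Proof.
rewrite [RHS]mpoly.mpolyE /dehomogenize (rmorph_homogenize (mpoly.comp_mpoly _)).
apply: eq_bigr => m _; rewrite /= mpoly.comp_mpolyC comp_mpoly_X tnth_mktuple unlift_none.
rewrite expr1n mul1r mpoly.mul_mpolyC mpoly.mpolyXE_id; congr (_ *: _).
by apply: eq_bigr => i _; rewrite comp_mpoly_X tnth_mktuple liftK.
Qed.

(** Both sides are substitutions, so comparing them on variables suffices: X_0 = 1 turns the
    extension back into [f]. *)
Lemma dehomogenize_comp f (A : mpoly N.+1 K) :
  dehomogenize (mpoly.comp_mpoly (projective_extension f) A) =
  mpoly.comp_mpoly f (dehomogenize A).
Proof.
rewrite /dehomogenize !comp_mpolyA; congr mpoly.comp_mpoly.
apply: eq_from_tnth => j; rewrite [LHS]tnth_mktuple [RHS]tnth_mktuple.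
case: (unliftP ord0 j) => [i|] ->; rewrite tnth_mktuple ?liftK ?unlift_none.
  by rewrite -/(dehomogenize _) dehomogenize_homogenize tnth_mktuple liftK comp_mpoly_X.
by rewrite rmorphXn /= comp_mpoly_X !tnth_mktuple unlift_none expr1n rmorph1.
Qed.

(** In a form of degree [d] the exponent of X_0 is determined by the others, so distinct monomials
    stay distinct when X_0 = 1. *)
Lemma dehomogenize_eq0 d (A : mpoly N.+1 K) : A \is d.-homog ->
  (dehomogenize A == 0) = (A == 0).
Proof.
move=> /mpoly.dhomogP Ad; apply/eqP/eqP => [dA|->]; last by rewrite /dehomogenize rmorph0.
pose tl (m : mpoly.multinom N.+1) : mpoly.multinom N :=
  mpoly.Multinom [tuple m (fintype.lift ord0 i) | i < N].
have tlE m i : tl m i = m (fintype.lift ord0 i) by rewrite mpoly.mnmE.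
have dAE : dehomogenize A =
    \sum_(m <- mpoly.msupp A) mpoly.mcoeff m A *: mpoly.mpolyX K (tl m).
  rewrite /dehomogenize mpoly.comp_mpolyE; apply: eq_bigr => m _; congr (_ *: _).
  rewrite big_ord_recl tnth_mktuple unlift_none expr1n mul1r mpoly.mpolyXE_id.
  by apply: eq_bigr => i _; rewrite tnth_mktuple liftK tlE.
apply/mpoly.mpolyP => m; rewrite mpoly.mcoeff0.
have [mA|/mpoly.memN_msupp_eq0//] := boolP (m \in mpoly.msupp A).
have := congr1 (mpoly.mcoeff (tl m)) dA; rewrite dAE mpoly.mcoeff0 raddf_sum /=.
rewrite (bigD1_seq m) ?mpoly.msupp_uniq //= mpoly.mcoeffZ mpoly.mcoeffX eqxx mulr1.
rewrite big_seq_cond big1 ?addr0 // => m' /andP[m'A m'm].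
rewrite mpoly.mcoeffZ mpoly.mcoeffX; case: eqP => [e|]; last by rewrite mulr0.
case/eqP: m'm; apply/mpoly.mnmP => j; case: (unliftP ord0 j) => [i|] ->.
  by rewrite -!tlE e.
have degE k : k \in mpoly.msupp A -> (\sum_i k i)%N = d.
  by move=> kA; rewrite -(Ad k kA); exact/esym/mpoly.mdegE.
have := degE m mA; rewrite -(degE m' m'A) !big_ord_recl.
have -> : (\sum_(i < N) m' (fintype.lift ord0 i) = \sum_(i < N) m (fintype.lift ord0 i))%N.
  by apply: eq_bigr => i _; rewrite -!tlE e.
by move/addIn => ->.
Qed.

(** Dominance speaks of forms; homogenising [p] and then setting X_0 = 1 transfers it to affine
    polynomials. *)
Lemma dominant_comp f p : dominant (projective_extension f) -> p != 0 ->
  mpoly.comp_mpoly f p != 0.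
Proof.
move=> fD p0; pose A := homogenize (msize p) p.
have Ah : A \is (msize p).-homog by exact: homogenize_dhomog.
have dA : dehomogenize A = p by exact: dehomogenize_homogenize.
have A0 : A != 0 by rewrite -(dehomogenize_eq0 Ah) dA.
have := fD _ _ Ah A0.
have := dhomog_comp Ah (projective_extension_dhomog f).
by move=> /dehomogenize_eq0 <-; rewrite dehomogenize_comp dA.
Qed.

(** The n-fold composite of the extension may acquire a power of X_0 that the extension of the
    iterate lacks; setting X_0 = 1 avoids comparing the two. *)
Lemma dominant_iter f n : dominant (projective_extension f) ->
  dominant (projective_extension (affine_iter f n)).
Proof.
move=> fD d A Ah A0.
rewrite -(dehomogenize_eq0 (dhomog_comp Ah (projective_extension_dhomog _))).
rewrite dehomogenize_comp.
have : dehomogenize A != 0 by rewrite (dehomogenize_eq0 Ah).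
elim: n (dehomogenize A) => [|n IH] p p0.
  by rewrite /affine_iter /= mpoly.comp_mpoly_id.
have -> : mpoly.comp_mpoly (affine_iter f n.+1) p =
    mpoly.comp_mpoly (affine_iter f n) (mpoly.comp_mpoly f p).
  by rewrite comp_mpolyA.
by apply: IH; exact: dominant_comp.
Qed.

End Maps.

(** * The extension of an affine map at points at infinity *)

Section FixedPoint.
Variables (K : fieldType) (N : nat).

(** Polynomials are read as univariate in X_0 over K[X_1, ..., X_N]; the coefficient of index 0 is
    the restriction to the hyperplane at infinity. *)
Definition poly_x0 : {rmorphism mpoly N.+1 K -> {poly mpoly N K}} :=
  mpoly.mmap (polyC \o @mpoly.mpolyC N K)
    (fun j => if unlift ord0 j is Some i then ('x_i)%:P else 'X).

Lemma poly_x0C c : poly_x0 (mpoly.mpolyC _ c) = (mpoly.mpolyC _ c)%:P.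
Proof. by rewrite [LHS]mpoly.mmapC. Qed.

Lemma poly_x0X0 : poly_x0 'x_ord0 = 'X.
Proof. by rewrite [LHS]mpoly.mmapX mpoly.mmap1U unlift_none. Qed.

Lemma poly_x0XS i : poly_x0 'x_(fintype.lift ord0 i) = ('x_i)%:P.
Proof. by rewrite [LHS]mpoly.mmapX mpoly.mmap1U liftK. Qed.

Lemma meval_x0_eq0 (p : mpoly N.+1 K) (x : 'I_N.+1 -> K) : x ord0 = 0 ->
  mpoly.meval x p = mpoly.meval (fun i => x (fintype.lift ord0 i)) (poly_x0 p)`_0.
Proof.
move=> x0; rewrite -horner_coef0.
pose u2 : {rmorphism mpoly N.+1 K -> K} :=
  mpoly.meval (fun i => x (fintype.lift ord0 i)) \o horner_eval 0 \o poly_x0.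
apply: (mpoly_rmorph_ext (u1 := mpoly.meval x) (u2 := u2)) => [c|j] /=.
  by rewrite poly_x0C /horner_eval hornerC !mpoly.mevalC.
rewrite mpoly.mevalXU; case: (unliftP ord0 j) => [i|] ->.
  by rewrite poly_x0XS /horner_eval hornerC mpoly.mevalXU.
by rewrite poly_x0X0 /horner_eval hornerX x0 rmorph0.
Qed.

(** The leading part of a component of maximal degree carries no power of X_0. In degree 0 the
    component of index 0 is the constant 1. *)
Lemma projective_extension_top (f : N.-tuple (mpoly N K)) :
  exists j, (poly_x0 (tnth (projective_extension f) j))`_0 != 0.
Proof.
set d := affine_degree f; have [d0|d0] := posnP d.
  exists ord0; rewrite projective_extension0 -/d d0 expr0 rmorph1.
  by rewrite -horner_coef0 hornerC oner_neq0.
have [i di] : exists i, (msize (tnth f i)).-1 = d.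
  apply: contrapT => /forallNP h.
  have : (d <= d.-1)%N; last lia.
  apply/bigmax_leqP => i _; have : ((msize (tnth f i)).-1 <= d)%N by exact: (leq_bigmax i).
  by have := h i; lia.
exists (fintype.lift ord0 i); rewrite projective_extensionS -/d rmorph_homogenize.
set p := tnth f i in di *.
have pE : msize p = d.+1 by move: di d0; case: (msize p) => [|k] /= <-.
have [m0 m0p m0d] : exists2 m0, m0 \in mpoly.msupp p & mpoly.mdeg m0 = d.
  apply: contrapT => h; suff : (msize p <= d)%N by rewrite pE ltnn.
  apply/bigmax_leqP_seq => m mp _.
  have : (mpoly.mdeg m < msize p)%N by exact: mpoly.mmeasure_mnm_lt.
  rewrite pE ltnS leq_eqVlt => /predU1P[e|//].
  by case: h; exists m.
(* The truncated exponent of X_0 is 0 exactly when [m] reaches degree [d], so only top-degree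
   monomials survive at X_0 = 0. *)
have termE m : (poly_x0 (mpoly.mpolyC N.+1 (mpoly.mcoeff m p)) *
    (poly_x0 'x_ord0 ^+ (d - mpoly.mdeg m) *
     \prod_(k < N) poly_x0 'x_(fintype.lift ord0 k) ^+ m k))`_0 =
    (mpoly.mdeg m >= d)%N%:R * (mpoly.mcoeff m p *: mpoly.mpolyX K m).
  rewrite poly_x0C poly_x0X0 (eq_bigr (fun k => ('x_k ^+ m k)%:P)); last first.
    by move=> k _; rewrite poly_x0XS rmorphXn.
  rewrite -rmorph_prod /= -mpoly.mpolyXE_id -!horner_coef0 !hornerE /= expr0n subn_eq0.
  by rewrite -mpoly.mul_mpolyC mulrCA mulrA.
apply: contraTneq (m0p) => e; rewrite mpoly.mcoeff_msupp negbK; apply/eqP; move: e.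
rewrite -horner_coef0 horner_sum => /(congr1 (mpoly.mcoeff m0)).
rewrite mpoly.mcoeff0 raddf_sum /= (bigD1_seq m0) ?mpoly.msupp_uniq //=.
rewrite horner_coef0 termE m0d leqnn mul1r mpoly.mcoeffZ mpoly.mcoeffX eqxx mulr1.
rewrite big1 ?addr0 // => m mm0.
rewrite horner_coef0 termE; case: (_ <= _)%N; last by rewrite mul0r mpoly.mcoeff0.
by rewrite mul1r mpoly.mcoeffZ mpoly.mcoeffX (negPf mm0) mulr0.
Qed.

(** X is prime and does not divide [b], so its powers divide [a]. *)
Lemma dvd_Xn_cancel (R : idomainType) (a b c : {poly R}) n :
  b`_0 != 0 -> a * b = c * 'X^n -> exists a', a = a' * 'X^n.
Proof.
move=> b0; elim: n a => [|n IH] a ab; first by exists a; rewrite mulr1.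
have : a`_0 = 0.
  apply/eqP; have /eqP := congr1 (fun p : {poly R} => p`_0) ab.
  by rewrite /= !coef0M coefXn mulr0 mulf_eq0 (negPf b0) orbF.
rewrite -horner_coef0 => /eqP/factor_theorem[e]; rewrite subr0 => aE.
rewrite {a}aE in ab *; move: e ab => a ab.
have [|a' ->] := IH a; last by exists a'; rewrite exprSr mulrA.
apply: (mulIf (monic_neq0 (monicX R))).
by rewrite mulrAC ab exprSr mulrA.
Qed.

(* The components of the extension have no common factor, hence any other
   representative is a multiple of it. *)
Lemma defined_with_value_extension (f : N.-tuple (mpoly N K)) (x y : 'rV[K]_N.+1) :
  x 0 ord0 = 0 -> defined_with_value (projective_extension f) x y ->
  same_point (projective_eval (projective_extension f) x) y.
Proof.
move=> x0 [d [G [_ Gprop Gx [c c0 Gy]]]].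
set F := projective_extension f in Gprop *.
have [j0 Fj0] := projective_extension_top f.
have F0 : poly_x0 (tnth F ord0) = 'X^(affine_degree f).
  by rewrite projective_extension0 rmorphXn /= poly_x0X0.
have GF j : poly_x0 (tnth G ord0) * poly_x0 (tnth F j) = poly_x0 (tnth G j) * 'X^(affine_degree f).
  rewrite -F0.
  apply: etrans (esym (rmorphM poly_x0 _ _)) _.
  exact: etrans (congr1 poly_x0 (Gprop ord0 j)) (rmorphM poly_x0 _ _).
(* X_0 does not divide F_j0, so proportionality forces the power F_0 of X_0 to divide G_0; the
   quotient [a] then satisfies G = a F. *)
have [a aE] := dvd_Xn_cancel Fj0 (GF j0).
have GE j : poly_x0 (tnth G j) = a * poly_x0 (tnth F j).
  apply: (@mulIf _ 'X^(affine_degree f)); first by rewrite monic_neq0 // monicXn.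
  by rewrite -GF aE mulrAC.
pose al := mpoly.meval (fun i => x 0 (fintype.lift ord0 i)) a`_0.
have GxE : projective_eval G x = al *: projective_eval F x.
  by apply/rowP => j; rewrite !mxE !(meval_x0_eq0 _ x0) GE coef0M rmorphM.
have al0 : al != 0 by apply: contraNneq Gx => al0; rewrite GxE al0 scale0r.
exists (al^-1 * c); first by rewrite mulf_neq0 ?invr_eq0.
by rewrite -scalerA -Gy GxE scalerA mulVf // scale1r.
Qed.

End FixedPoint.

(** * Linear extension of maps to formal sums *)

Section FreegLinear.
Variables (L : choiceType) (S : nzRingType).

Lemma freegZU (c k : S) (z : L) : c *: << k *g z >> = << (c * k) *g z >>.
Proof. by apply/eqP/freeg_eqP => x; rewrite coeffZ !coeffU mulrA. Qed.

Lemma freeg_sumZ (D : {freeg L / S}) : D = \sum_(A <- dom D) coeff A D *: << A >>.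
Proof.
by rewrite -{1}(freeg_sumE D); apply: eq_bigr => A _; rewrite freegZU mulr1.
Qed.

HB.instance Definition _ (M : lmodType S) (g : L -> M) :=
  GRing.isZmodMorphism.Build {freeg L / S} M (fglift g) (lift_is_additive g).

Lemma fglift_sumE (M : lmodType S) (g : L -> M) (D : {freeg L / S}) :
  fglift g D = \sum_(A <- dom D) coeff A D *: g A.
Proof.
by rewrite -{1}(freeg_sumE D) raddf_sum; apply: eq_bigr => A _; rewrite /= liftU.
Qed.

Lemma fglift_scalable (M : lmodType S) (g : L -> M) : scalable (fglift g).
Proof.
move=> c D; rewrite [in RHS]fglift_sumE scaler_sumr.
transitivity (fglift g (\sum_(A <- dom D) << (c * coeff A D) *g A >>)).
  by congr fglift.
by rewrite raddf_sum; apply: eq_bigr => A _; rewrite /= liftU scalerA.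
Qed.

HB.instance Definition _ (M : lmodType S) (g : L -> M) :=
  GRing.isScalable.Build S {freeg L / S} M *:%R (fglift g) (fglift_scalable g).

Lemma fgliftU1 (M : lmodType S) (g : L -> M) z : fglift g << z >> = g z.
Proof. by rewrite liftU scale1r. Qed.

End FreegLinear.

(** * The Neron-Severi space of P^N, pullbacks and the dynamical degree *)

Section DynamicalDegree.
Variables (R : realType) (K : fieldType) (N : nat).
Local Notation divisor := {freeg (mpoly N.+1 K) / R[i]}.
Implicit Types (A B : mpoly N.+1 K) (D : divisor) (F : N.+1.-tuple (mpoly N.+1 K)).

(** On divisors this induces the identification of NS(P^N) tensored with C with C. *)
Definition divisor_degree : {linear divisor -> R[i]^o} :=
  fglift (fun A => ((msize A).-1)%:R : R[i]^o).

Lemma divisor_degreeE D :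
  divisor_degree D = \sum_(A <- dom D) coeff A D * ((msize A).-1)%:R.
Proof. exact: fglift_sumE. Qed.

Lemma divisor_degreeU A : divisor_degree << A >> = ((msize A).-1)%:R.
Proof. exact: fgliftU1. Qed.

Lemma msize_dhomog d A : A != 0 -> A \is d.-homog -> (msize A).-1 = d.
Proof.
by move=> A0 Ad; apply: (mpoly.dhomog_uniq A0 _ Ad); exact: mpoly.dhomog_msize Ad.
Qed.

Lemma divisor_degree_trivial D : ns_trivial D -> divisor_degree D = 0.
Proof.
elim=> [|D1 D2 _ h1 _ h2|c D1 _ h|A B /andP[A0 _] /andP[B0 _]|d A B A0 B0 Ad Bd].
- exact: linear0.
- by rewrite linearD /= h1 h2 addr0.
- by rewrite linearZ /= h scaler0.
- rewrite !linearB /= !divisor_degreeU mpoly.msizeM //.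
  rewrite -addrA -opprD -natrD; apply/eqP; rewrite subr_eq0; apply/eqP; congr (_%:R).
  have : (0 < msize A)%N by rewrite lt0n mpoly.mmeasure_poly_eq0.
  have : (0 < msize B)%N by rewrite lt0n mpoly.mmeasure_poly_eq0.
  by move: (msize A) (msize B); lia.
- rewrite linearB /= !divisor_degreeU.
  by rewrite (msize_dhomog A0 Ad) (msize_dhomog B0 Bd) subrr.
Qed.

Lemma ns_trivial_sum (I : eqType) (r : seq I) (E : I -> divisor) :
  (forall i, i \in r -> ns_trivial (E i)) -> ns_trivial (\sum_(i <- r) E i).
Proof.
move=> h; rewrite big_seq; elim/big_ind: _ => //; first exact: ns_trivial0.
by move=> *; apply: ns_trivialD.
Qed.

Lemma x0n_neq0 k : ('x_ord0 : mpoly N.+1 K) ^+ k != 0.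
Proof. by rewrite expf_neq0 // -mpoly.msize_poly_eq0 mpoly.mmeasureX. Qed.

Lemma x0n_form k : is_form (('x_ord0 : mpoly N.+1 K) ^+ k).
Proof. by rewrite /is_form x0n_neq0; apply: mpoly.homogE (dhomog_Xn _ k ord0). Qed.

(** [A] is linearly equivalent to a power of X_0, which multiplicativity splits into copies of
    X_0. *)
Lemma ns_trivial_form A : is_form A ->
  ns_trivial (<< A >> - ((msize A).-1)%:R *: << 'x_ord0 >> : divisor).
Proof.
move=> /andP[A0 Ah]; set d := (msize A).-1.
have Ad : A \is d.-homog by rewrite -mpoly.homog_msize.
rewrite -(subrKA (<< 'x_ord0 ^+ d >> : divisor)); apply: ns_trivialD.
  exact: ns_trivial_lin A0 (x0n_neq0 d) Ad (dhomog_Xn _ d ord0).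
elim: d {Ad} => [|d IH].
  (* In degree 0 the relation for the product 1 = 1 * 1 reads -div(1) = 0. *)
  rewrite expr0 scale0r subr0.
  have := ns_trivialM R (x0n_form 0) (x0n_form 0).
  rewrite expr0 mulr1 subrr add0r => /(ns_trivialZ (-1)).
  by rewrite scaleN1r opprK.
set b : divisor := << 'x_ord0 >> in IH *; set c : divisor := << _ ^+ d >> in IH.
have -> : << 'x_ord0 ^+ d.+1 >> - d.+1%:R *: b =
    (<< 'x_ord0 * 'x_ord0 ^+ d >> - b - c) + (c - d%:R *: b).
  by rewrite subrKA exprS -natr1 scalerDl scale1r opprD addrA addrAC.
by apply: ns_trivialD => //; exact: ns_trivialM (x0n_form 1) (x0n_form d).
Qed.

Lemma ns_trivial_divisor D : is_divisor D ->
  ns_trivial (D - divisor_degree D *: << 'x_ord0 >>).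
Proof.
move=> /allP Df; rewrite divisor_degreeE {1}(freeg_sumZ D) scaler_suml -sumrB.
apply: ns_trivial_sum => A AD.
rewrite -scalerA -scalerBr; apply/ns_trivialZ/ns_trivial_form; exact: Df.
Qed.

Lemma divisor_degree_pullback F d D : dominant F -> (forall j, tnth F j \is d.-homog) ->
  is_divisor D -> divisor_degree (pullback F D) = d%:R * divisor_degree D.
Proof.
move=> Fdom Fd /allP Df; rewrite {1}/pullback fglift_sumE linear_sum /= divisor_degreeE.
rewrite mulr_sumr [LHS]big_seq [RHS]big_seq; apply: eq_bigr => A /Df/andP[A0 Ah].
have Ad : A \is ((msize A).-1).-homog by rewrite -mpoly.homog_msize.
rewrite linearZ /= divisor_degreeU.
rewrite (msize_dhomog (Fdom _ _ Ad A0) (dhomog_comp Ad Fd)) natrM.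
by rewrite -[_ *: _]/(_ * _) mulrCA.
Qed.

(** A nontrivial class has nonzero degree, and pullback multiplies degrees by [d]; taking degrees in
    the eigenvector relation yields the eigenvalue. *)
Lemma ns_eigenvalueE F d (l : R[i]) : dominant F -> (forall j, tnth F j \is d.-homog) ->
  ns_eigenvalue F l -> l = d%:R.
Proof.
move=> Fdom Fd [D [Ddiv Dnt Dl]].
have dD0 : divisor_degree D != 0.
  apply/eqP => e; apply: Dnt; have := ns_trivial_divisor Ddiv.
  by rewrite e scale0r subr0.
have := divisor_degree_trivial Dl.
rewrite linearB linearZ /=.
rewrite (divisor_degree_pullback Fdom Fd Ddiv) -[_ *: _]/(_ * _) -mulrBl => /eqP.
by rewrite mulf_eq0 (negPf dD0) orbF subr_eq0 => /eqP.
Qed.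

(** The moduli of eigenvalues form a subset of {d}: either the empty set, whose [sup] is 0, or {d}
    itself. *)
Lemma ns_spectral_radius_bound F d : dominant F -> (forall j, tnth F j \is d.-homog) ->
  0 <= ns_spectral_radius R F <= d%:R.
Proof.
move=> Fdom Fd; rewrite /ns_spectral_radius; set S := [set _ | _ in _].
have : S `<=` [set d%:R].
  move=> _ [l /(ns_eigenvalueE Fdom Fd) -> <-] /=.
  by rewrite -(rmorph_nat (real_complex R)) /= expr0n /= addr0 sqrtr_sqr normr_nat.
by move/subset_set1 => [->|->]; rewrite ?sup0 ?sup1 ?lexx ?ler0n.
Qed.

(** Along the indices m(k+1) submultiplicativity bounds every term by the m-th root of the degree of
    f^m, and the limit inherits the bound. *)
Lemma dynamical_degree_exp_le (f : N.-tuple (mpoly N K)) (m : nat) :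
  dominant (projective_extension f) -> 0 < dynamical_degree R f -> (0 < m)%N ->
  dynamical_degree R f ^+ m <= (affine_degree (affine_iter f m))%:R.
Proof.
move=> fD; rewrite /dynamical_degree; set u := (fun n : nat => _ `^ _).
move=> d0 m0; set d := affine_degree _.
(* A divergent sequence would have [limn] equal to the default 0, against positivity. *)
have cu : cvgn u.
  by apply: contrapT => /dvgP e; rewrite e ltxx in d0.
have rho n : 0 <= ns_spectral_radius R (projective_extension (affine_iter f n)) <=
    (affine_degree (affine_iter f n))%:R.
  apply: ns_spectral_radius_bound; first exact: dominant_iter.
  exact: projective_extension_dhomog.
have un k : u (m * k.+1)%N <= d%:R `^ m%:R^-1.
  rewrite /u; have /andP[r0 r1] := rho (m * k.+1)%N.
  have mk0 : (m * k.+1)%:R != 0 :> R by rewrite pnatr_eq0 muln_eq0 negb_or -lt0n m0.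
  apply: le_trans (_ : (d%:R ^+ k.+1) `^ ((m * k.+1)%:R)^-1 <= _).
    apply: ge0_ler_powR; rewrite ?invr_ge0 ?ler0n ?nnegrE ?exprn_ge0 //.
    by rewrite (le_trans r1) // -natrX ler_nat; exact: affine_degree_iterM.
  rewrite -powR_mulrn // -powRrM natrM invfM mulrCA mulfV ?mulr1 // pnatr_eq0.
have le_c : limn u <= d%:R `^ m%:R^-1.
  rewrite leNgt; apply/negP => lt_c.
  have [n0 _ hn] := cvgr_gt _ cu _ lt_c.
  have := un n0; rewrite leNgt => /negP; apply; apply: hn => /=.
  by rewrite (leq_trans (leqnSn _)) // leq_pmull.
apply: le_trans (_ : (d%:R `^ m%:R^-1) ^+ m <= _).
  by rewrite lerXn2r // nnegrE ?powR_ge0 // ltW.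
by rewrite -powR_mulrn ?powR_ge0 // -powRrM mulVf ?powRr1 // pnatr_eq0 -lt0n.
Qed.

End DynamicalDegree.

(** * Local dynamics and heights *)

Section LocalDynamics.
Variables (F : fieldType) (v : F -> int).
Hypothesis vP : discrete_valuation v.

Definition mpoly_integral n (p : mpoly n F) := forall m, vge v 0 (mpoly.mcoeff m p).

Lemma vge_prod_exp_sub n (x y : 'I_n -> F) (e : 'I_n -> nat) :
  (forall i, vge v 0 (x i)) -> (forall i, vge v 0 (y i)) ->
  (forall i, vge v 1 (x i - y i)) ->
  vge v 1 (\prod_i x i ^+ e i - \prod_i y i ^+ e i).
Proof.
move=> hx hy hxy.
pose C a b := [/\ vge v 0 a, vge v 0 b & vge v 1 (a - b)].
have C1 : C 1 1 by split; rewrite ?subrr ?vge0 ?vge1.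
have CM a b a' b' : C a b -> C a' b' -> C (a * a') (b * b').
  move=> [a0 b0 ab] [a0' b0' ab']; split; try exact: (vge_mul0 vP).
  have -> : a * a' - b * b' = a * (a' - b') + b' * (a - b) by ring.
  by apply: (vgeD vP); exact: (vge_mul0 vP).
suff [] : C (\prod_i x i ^+ e i) (\prod_i y i ^+ e i) by [].
apply: (big_ind2 C C1 CM) => i _.
elim: (e i) => [|k IH]; first by rewrite !expr0.
by rewrite !exprS; apply: CM.
Qed.

Lemma vge_meval_sub n (p : mpoly n F) (x y : 'I_n -> F) : mpoly_integral p ->
  (forall i, vge v 0 (x i)) -> (forall i, vge v 0 (y i)) ->
  (forall i, vge v 1 (x i - y i)) ->
  vge v 1 (mpoly.meval x p - mpoly.meval y p).
Proof.
move=> hp hx hy hxy; rewrite !mpoly.mevalE -sumrB; apply: (vge_sum vP) => m _.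
by rewrite -mulrBr; apply: (vge_mul0 vP) => //; exact: vge_prod_exp_sub.
Qed.

Lemma vge_meval_lower n (p : mpoly n F) (x : 'I_n -> F) (d b : nat) :
  mpoly_integral p -> (msize p <= d.+1)%N -> (forall i, vge v (- b%:Z) (x i)) ->
  vge v (- (b * d)%N%:Z) (mpoly.meval x p).
Proof.
move=> hp pd hx; rewrite mpoly.mevalE big_seq; apply: (vge_sum vP) => m mp.
apply: (vge_mul0 vP) => //.
have md : (\sum_i m i <= d)%N.
  rewrite -ltnS; apply: leq_trans pd; have := mpoly.msize_mdeg_lt mp.
  by rewrite mpoly.mdegE.
apply: (@vge_le _ _ (- (b * \sum_i m i)%N%:Z)).
  by rewrite lerN2 lez_nat leq_mul2l md orbT.
elim/big_rec2: _ => [|i s a _ IH]; first by rewrite muln0 oppr0; exact: vge1.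
rewrite mulnDr PoszD opprD; apply: (vgeM vP) => //.
by have := vgeX vP (m i) (hx i); rewrite -mulr_natr mulNr natz PoszM.
Qed.

Variable N : nat.
Implicit Types (q x : 'rV[F]_N.+1).

(* The points whose reduction is that of q, where q_j = 1. *)
Definition residue_disk q (j : 'I_N.+1) : set 'rV[F]_N.+1 :=
  [set x | x 0 j != 0 /\ forall i, vge v 1 (x 0 i / x 0 j - q 0 i)].

(** After division by x_j, [z] is integral and congruent to [q], so G(z) is congruent to l q and its
    j-th coordinate is a unit; homogeneity contributes the factor x_j^d. *)
Lemma residue_disk_step (G : N.+1.-tuple (mpoly N.+1 F)) q (d : nat) (l : F) j x :
  (forall i, tnth G i \is d.-homog) -> (forall i, mpoly_integral (tnth G i)) ->
  (forall i, vge v 0 (q 0 i)) -> q 0 j = 1 -> l != 0 -> v l = 0 ->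
  projective_eval G q = l *: q -> residue_disk q j x ->
  residue_disk q j (projective_eval G x) /\ v (projective_eval G x 0 j) = v (x 0 j) *+ d.
Proof.
move=> Gd GI q0 qj l0 vl Gq [xj hx].
pose z i := x 0 i / x 0 j.
have z0 i : vge v 0 (z i).
  by rewrite -(subrK (q 0 i) (z i)); apply: (vgeD vP) => //; apply: vge_le (hx i).
have Gz i : projective_eval G x 0 i = x 0 j ^+ d * mpoly.meval z (tnth G i).
  by rewrite mxE; apply: meval_dhomog => // k; rewrite /z mulrC divfK.
have cong i : vge v 1 (mpoly.meval z (tnth G i) - l * q 0 i).
  have -> : l * q 0 i = mpoly.meval (q 0) (tnth G i).
    by have := congr1 (fun u : 'rV_N.+1 => u 0 i) Gq; rewrite !mxE => ->.
  exact: vge_meval_sub.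
have [Gj0 vGj] : mpoly.meval z (tnth G j) != 0 /\ v (mpoly.meval z (tnth G j)) = 0.
  by apply: (dval_add_gt vP l0 vl); have := cong j; rewrite qj mulr1.
have xd0 : x 0 j ^+ d != 0 by rewrite expf_neq0.
split; last by rewrite Gz (dvalM vP) // vGj addr0 (dvalX vP).
split; first by rewrite Gz mulf_neq0.
move=> i; rewrite !Gz.
have -> : x 0 j ^+ d * mpoly.meval z (tnth G i) / (x 0 j ^+ d * mpoly.meval z (tnth G j)) - q 0 i =
  (mpoly.meval z (tnth G j))^-1 * ((mpoly.meval z (tnth G i) - l * q 0 i) -
    q 0 i * (mpoly.meval z (tnth G j) - l * q 0 j)).
  by rewrite qj; field; rewrite xd0 Gj0.
apply: (vge_mul0 vP); first by rewrite vgeP ?invr_eq0 // (dvalV vP) // vGj.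
by apply: (vgeB vP) => //; exact: (vge_mul0 vP).
Qed.

Lemma residue_disk_iter (g : N.-tuple (mpoly N F)) q (l : F) j P k :
  (forall i, mpoly_integral (tnth (projective_extension g) i)) ->
  (forall i, vge v 0 (q 0 i)) -> q 0 j = 1 -> l != 0 -> v l = 0 ->
  projective_eval (projective_extension g) q = l *: q ->
  residue_disk q j (affine_point P) ->
  residue_disk q j (affine_point (iter k (affine_eval g) P)) /\
  v (affine_point (iter k (affine_eval g) P) 0 j) =
    v (affine_point P 0 j) *+ affine_degree g ^ k.
Proof.
move=> gI q0 qj l0 vl gq hP; elim: k => [|k [IH1 IH2]] //=.
have := residue_disk_step (projective_extension_dhomog g) gI q0 qj l0 vl gq IH1.
by rewrite projective_eval_affine IH2 -mulrnA -expnSr.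
Qed.

(** A vector congruent to [q] modulo the maximal ideal still has a unit as j-th coordinate, and
    dividing by it preserves the congruence. *)
Lemma residue_disk_nbhs q j : v (q 0 j) = 0 -> q 0 j != 0 -> (forall i, vge v 0 (q 0 i)) ->
  projective_nbhs v q [set x | x != 0 /\ residue_disk ((q 0 j)^-1 *: q) j x].
Proof.
move=> vj qj q0; split; first split.
- by move=> x [].
- move=> c x c0 [x0 [xj hx]]; split; first by rewrite scaler_eq0 negb_or c0.
  split; first by rewrite mxE mulf_neq0.
  move=> i; have := hx i; rewrite !mxE.
  by have -> : c * x 0 i / (c * x 0 j) = x 0 i / x 0 j by field; rewrite c0 xj.
- exists 1 => y hy; have [yj vy] := dval_add_gt vP qj vj (hy j).
  split; first by apply: contraNneq yj => ->; rewrite mxE.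
  split=> // i; rewrite mxE.
  have -> : y 0 i / y 0 j - (q 0 j)^-1 * q 0 i =
    (y 0 j)^-1 * ((y 0 i - q 0 i) - q 0 i * ((q 0 j)^-1 * (y 0 j - q 0 j))).
    by field; rewrite yj qj.
  apply: (vge_mul0 vP); first by rewrite vgeP ?invr_eq0 // (dvalV vP) // vy.
  apply: (vgeB vP) => //; do 2!apply: (vge_mul0 vP) => //.
  by rewrite vgeP ?invr_eq0 // (dvalV vP) // vj.
Qed.

Lemma affine_iter_lower (f : N.-tuple (mpoly N F)) (P : 'rV[F]_N) (b s d : nat) :
  (forall i, mpoly_integral (tnth f i)) -> (affine_degree f <= d)%N ->
  (forall i, vge v (- b%:Z) (P 0 i)) ->
  forall i, vge v (- (b * d ^ s)%N%:Z) (iter s (affine_eval f) P 0 i).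
Proof.
move=> fI fd hP; elim: s => [|s IH] i /=; first by rewrite muln1.
rewrite mxE expnSr mulnA; apply: vge_meval_lower => //.
exact/affine_degreeP.
Qed.

End LocalDynamics.

(** * Heights as sums of local terms *)

Section Height.
Variables (R : realType) (K : fieldExtType rat) (N : nat).
Implicit Types (p : prime_place K) (x : 'rV[K]_N.+1).

Local Notation local_height p x :=
  (ln (\big[Num.max/0]_(j < N.+1) place_abs R p (x 0 j))).

Lemma place_abs_le1 p (c : K) : vge p 0 c -> place_abs R p c <= 1.
Proof.
rewrite /vge /place_abs; case: eqP => //= _.
(* [place_norm] is 0 when the residue field is infinite; its powers are then 0 or 1. *)
case: (p c) => // n _; have [->|N0] := posnP (place_norm p).
  by rewrite exp0rz; case: (_ == _); rewrite ?lexx ?ler01.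
by rewrite -exprz_inv -exprnP exprVn invf_le1 ?exprn_ege1 ?exprn_gt0 ?ltr0n // ler1n.
Qed.

Lemma local_height_ge0 p x : x 0 ord0 = 1 -> 0 <= local_height p x.
Proof.
move=> x0; apply: ln_ge0; apply: le_trans (le_bigmax _ _ ord0).
by rewrite /place_abs x0 oner_eq0 (dval1 (placeP p)).
Qed.

(** Failing [vge] at -b means a pole of order at least b + 1, whence the [b.+1]. *)
Lemma local_height_ge p x j (b : nat) : (1 < place_norm p)%N ->
  ~~ vge p (- b%:Z) (x 0 j) -> b.+1%:R * ln (place_norm p)%:R <= local_height p x.
Proof.
move=> Np; rewrite negb_or -ltNge => /andP[xj vx].
have N0 : 0 < (place_norm p)%:R :> R by rewrite ltr0n ltnW.
rewrite mulr_natl -lnXn // ler_ln ?posrE ?exprn_gt0 //; last first.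
  apply: lt_le_trans (le_bigmax _ _ j); rewrite /place_abs (negPf xj).
  by rewrite exprz_gt0.
apply: le_trans (le_bigmax _ _ j); rewrite /place_abs (negPf xj).
rewrite exprnP ler_weXz2l //; last by move: vx; lia.
by rewrite ler1n ltnW.
Qed.

(** A nonzero local height needs a pole of some coordinate, and each coordinate has finitely many
    poles. *)
Lemma finite_local_height x : x 0 ord0 = 1 -> finite_set [set p | local_height p x != 0].
Proof.
move=> x0; apply: (@sub_finite_set _ _
  (\bigcup_(j in [set: 'I_N.+1]) [set p : prime_place K | p (x 0 j) < 0])); last first.
  by apply: bigcup_finite => [|j _]; [exact: finite_finset | exact: finite_places_lt0].
move=> p /=; apply: contra_neqP => h.
suff -> : \big[Num.max/0]_(j < N.+1) place_abs R p (x 0 j) = 1 by rewrite ln1.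
apply/le_anti/andP; split.
  apply: bigmax_le => // j _; apply: place_abs_le1; rewrite /vge leNgt.
  by apply/orP; right; apply/negP => pj; apply: h; exists j.
apply: le_trans (le_bigmax _ _ ord0).
by rewrite /place_abs x0 oner_eq0 (dval1 (placeP p)).
Qed.

(** The coordinate 1 makes all local terms nonnegative, archimedean ones included. Finite support
    matters because a sum with infinite support is 0 by convention. *)
Lemma weil_height_ge_local p x : x 0 ord0 = 1 ->
  local_height p x / (\dim {:K})%:R <= weil_height R x.
Proof.
move=> x0; rewrite /weil_height ler_pM2r; last first.
  by rewrite invr_gt0 ltr0n adim_gt0.
rewrite -[X in X <= _]add0r; apply: lerD.
  apply: fsumr_ge0 => _ [g ->]; apply: ln_ge0; apply: le_trans (le_bigmax _ _ ord0).
  by rewrite x0 rmorph1 /= expr0n /= addr0 expr1n sqrtr1.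
have /finite_seqP[s sE] := finite_local_height x0.
have ns q : q \notin undup s -> local_height q x = 0.
  rewrite mem_undup => qs; apply: contrapT => /eqP h.
  have : [set` s] q by rewrite -sE.
  by move=> /= qs'; rewrite qs' in qs.
rewrite (fsbigE _ _ (undup_uniq s) _ (fun q _ => ns q)) //.
rewrite (eq_bigl xpredT) => [|q]; last by rewrite in_setT.
have [ps|/ns ->] := boolP (p \in undup s); last first.
  by apply: sumr_ge0 => q _; exact: local_height_ge0.
rewrite (bigD1_seq p) ?undup_uniq //= lerDl.
by apply: sumr_ge0 => q _; exact: local_height_ge0.
Qed.

End Height.

(** * Growth of heights along orbits near the fixed point *)

Lemma limn_einf_ge (R : realType) (u : nat -> \bar R) (c : \bar R) :
  (forall n, (c <= u n)%E) -> (c <= limn_einf u)%E.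
Proof.
move=> h; rewrite limn_einf_lim; apply: lime_ge; first exact: is_cvg_einfs.
by apply: nearW => n; apply: le_ereal_inf_tmp => _ [k _ <-].
Qed.

Theorem theorem19 (R : realType) (K : fieldExtType rat) (N : nat)
    (f : N.-tuple (mpoly N K)) (m : nat) (Q0 : 'rV[K]_N.+1)
    (f_dominant : dominant (projective_extension f))
    (f_degree : 1 < dynamical_degree R f)
    (m_gt0 : (1 <= m)%N)
    (Q0_neq0 : Q0 != 0)
    (Q0_infinity : Q0 0 ord0 = 0)
    (Q0_fixed :
      defined_with_value (projective_extension (affine_iter f m)) Q0 Q0) :
  exists (p : prime_place K) (U : set 'rV[place_completion p]_N.+1),
    projective_nbhs (@compl_val K p (place_completion p))
      (map_mx (compl_emb (place_completion p)) Q0) U /\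
    forall P : 'rV[K]_N,
      U (map_mx (compl_emb (place_completion p)) (affine_point P)) ->
      (0 < lower_canonical_height R f P)%E.
Proof.
set g := affine_iter f m in Q0_fixed; set D := affine_degree g.
set delta := dynamical_degree R f in f_degree.
have delta_le : delta ^+ m <= D%:R.
  by apply: dynamical_degree_exp_le => //; exact: lt_trans f_degree.
have [c c0 gQ0] := defined_with_value_extension Q0_infinity Q0_fixed.
have /existsP[j Qj] : [exists j, Q0 0 j != 0].
  apply: contraNT Q0_neq0 => /existsPn h; apply/eqP/rowP => j.
  by rewrite mxE; apply/eqP; have := h j; rewrite negbK.
pose q := (Q0 0 j)^-1 *: Q0.
have qj : q 0 j = 1 by rewrite mxE mulVf.
have j0 : j != ord0 by apply: contraNneq Qj => ->; rewrite Q0_infinity.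
pose G := projective_extension g.
(* Rescaling Q0 multiplies its image by the [D]-th power of the scalar, which gives the multiplier
   explicitly. *)
have [l l0 gq] : exists2 l, l != 0 & projective_eval G q = l *: q.
  exists (((Q0 0 j)^-1) ^+ D * c * Q0 0 j); first by rewrite !mulf_neq0 ?expf_neq0 ?invr_eq0.
  rewrite /q scalerA mulfK // -scalerA -gQ0; apply/rowP => i; rewrite !mxE.
  apply: meval_dhomog; first exact: projective_extension_dhomog.
  by move=> k; rewrite mxE.
pose coefs n (h : n.-tuple (mpoly n K)) :=
  flatten [seq [seq mpoly.mcoeff mm (tnth h i) | mm <- mpoly.msupp (tnth h i)] | i <- enum 'I_n].
(* An element listed with its inverse becomes a unit; the coefficient lists make [f] and [G]
   integral. *)
pose xs := [:: l; l^-1; Q0 0 j; (Q0 0 j)^-1] ++ [seq Q0 0 i | i <- enum 'I_N.+1] ++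
  coefs _ f ++ coefs _ G.
have [p hxs Np] := exists_place xs; have pP := placeP p.
have coefsI n (h : n.-tuple (mpoly n K)) i : {subset coefs _ h <= xs} ->
    mpoly_integral p (tnth h i).
  move=> sub mm; have [mh|/mpoly.memN_msupp_eq0 ->] := boolP (mm \in mpoly.msupp (tnth h i)).
    apply/hxs/sub/flattenP; exists [seq mpoly.mcoeff mm (tnth h i) | mm <- mpoly.msupp (tnth h i)].
      by apply/mapP; exists i; rewrite ?mem_enum.
    by apply/mapP; exists mm.
  exact: vge0.
have fI i : mpoly_integral p (tnth f i).
  by apply: coefsI => y; rewrite !mem_cat => ->; rewrite !orbT.
have GI i : mpoly_integral p (tnth G i).
  by apply: coefsI => y; rewrite !mem_cat => ->; rewrite !orbT.
have vl : p l = 0 by apply: (vge_unit pP l0); apply: hxs; rewrite !inE eqxx ?orbT.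
have vQj : p (Q0 0 j) = 0.
  by apply: (vge_unit pP Qj); apply: hxs; rewrite !inE eqxx ?orbT.
have QI i : vge p 0 (Q0 0 i).
  apply: hxs; rewrite !mem_cat; apply/orP; right; apply/orP; left.
  by apply/mapP; exists i; rewrite ?mem_enum.
have qI i : vge p 0 (q 0 i).
  by rewrite mxE; apply: (vge_mul0 pP) => //; apply: hxs; rewrite !inE eqxx ?orbT.
pose L := place_completion p; pose e := compl_emb L.
exists p, [set x | x != 0 /\
  residue_disk (@compl_val _ _ L) ((map_mx e Q0 0 j)^-1 *: map_mx e Q0) j x].
split.
  apply: residue_disk_nbhs => [|||i]; first exact: compl_valP.
  - by rewrite mxE compl_embP.
  - by rewrite mxE fmorph_eq0.
  - by rewrite mxE compl_emb_vge.
move=> P [_ [Pj hP]].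
have diskP : residue_disk p q j (affine_point P).
  split; first by move: Pj; rewrite mxE fmorph_eq0.
  move=> i; have := hP i; rewrite !mxE -!fmorphV -!rmorphM -rmorphB.
  by rewrite compl_emb_vge.
pose a := affine_point P 0 j.
(* The coordinate of index 0 is 1 for P and 0 for [q], so the disk condition there says that 1/a has
   positive valuation. *)
have va : p a <= -1.
  have [a0] := diskP; move=> /(_ ord0); rewrite [affine_point P 0 ord0]mxE unlift_none.
  rewrite [q 0 ord0]mxE Q0_infinity mulr0 subr0 div1r vgeP ?invr_eq0 // (dvalV pP) //.
  by rewrite -/a; move: (p a) => c1; clear; lia.
(* The successor keeps [d] positive, so its powers are nondecreasing in the exponent. *)
set d := (affine_degree f).+1.
(* The factor [d ^ m] pays for the at most [m] extra steps that lead from f^n(P) to an iterate of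
   [g]. *)
pose cst : R := ln (place_norm p)%:R / (\dim {:K})%:R / (d ^ m)%:R.
have lnN : 0 < ln (place_norm p)%:R :> R by rewrite ln_gt0 // ltr1n.
have cst0 : 0 < cst by rewrite !divr_gt0 // ltr0n ?adim_gt0 ?expn_gt0.
apply: (@lt_le_trans _ _ cst%:E); first by rewrite lte_fin.
apply: limn_einf_ge => n; rewrite lee_fin.
have delta0 : 0 < delta by exact: lt_trans f_degree.
rewrite ler_pdivlMr ?exprn_gt0 //.
set y := iter n (affine_eval f) P.
(* Going forward to the next multiple of [m] bounds the height of f^n(P) from below by that of a
   later iterate. *)
pose k := (n %/ m)%N; pose s := (m - n %% m)%N.
have ns : (n + s = m * k.+1)%N.
  rewrite /s {1}(divn_eq n m) -addnA subnKC; last by rewrite ltnW // ltn_pmod.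
  by rewrite mulnS addnC mulnC.
have yk : iter s (affine_eval f) y = iter k.+1 (affine_eval g) P.
  rewrite -iterD addnC ns mulnC; elim: k.+1 => [|k' IH] //.
  by rewrite mulSn iterD IH /= affine_eval_iter.
have [_ vyk] := residue_disk_iter pP k.+1 GI qI qj l0 vl gq diskP.
rewrite -yk -/a -/D in vyk.
(* The least such [b] is the exact pole order of [y] once it is shown to be positive. *)
have exb : exists b : nat, [forall i, vge p (- b%:Z) (y 0 i)].
  pose w (i : 'I_N) := absz (p (y 0%R i)).
  exists (\max_i w i); apply/forallP => i; rewrite /vge; apply/orP; right.
  have : (w i <= \max_i w i)%N by exact: leq_bigmax.
  rewrite [w i]/w; move: (\max_i w i)%N (p _) => b c1; clear; lia.
have := ex_minnP exb; case=> b /forallP hb bmin.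
have := affine_iter_lower (d := d) pP s fI (leqnSn _) hb.
(* The pole at [j] of the later iterate has order at least [D ^ k.+1], while [s] steps of [f]
   multiply pole orders by at most [d ^ s]. *)
move=> lower; have Db : (D ^ k.+1 <= b * d ^ m)%N.
  have [i ji] : exists i, j = fintype.lift ord0 i.
    by case: (unliftP ord0 j) j0 => [i ->|->]; [exists i | rewrite eqxx].
  have := lower i; have yj0 : affine_point (iter s (affine_eval f) y) 0 j != 0.
    by rewrite yk; have [[]] := residue_disk_iter pP k.+1 GI qI qj l0 vl gq diskP.
  move: vyk yj0; rewrite ji mxE liftK => vyk yj0; rewrite vgeP // vyk.
  have : (b * d ^ s <= b * d ^ m)%N by rewrite leq_mul2l leq_pexp2l ?leq_subr ?orbT.
  rewrite -mulr_natr natz; move: (b * d ^ s)%N (b * d ^ m)%N (D ^ _)%N => b1 b2 b3.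
  by move: va; move: (p a) => c1; clear; nia.
have D0 : (0 < D)%N.
  rewrite lt0n; apply: contraTneq delta_le => ->.
  by rewrite -ltNge exprn_gt0.
have b0 : (0 < b)%N.
  have : (0 < b * d ^ m)%N by rewrite (leq_trans _ Db) // expn_gt0 D0.
  by rewrite muln_gt0 => /andP[].
(* By minimality of [b] some coordinate violates the bound for [b.-1]. *)
have [i hi] : exists i, ~~ vge p (- (b.-1)%:Z) (affine_point y 0 i).
  apply: contrapT => /forallNP h.
  suff : (b <= b.-1)%N by rewrite leqNgt ltn_predL b0.
  apply: bmin; apply/forallP => i; have := h (fintype.lift ord0 i).
  by rewrite mxE liftK => /negP; rewrite negbK.
have y1 : affine_point y 0 ord0 = 1 by rewrite mxE unlift_none.
apply: le_trans (weil_height_ge_local R p y1).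
have := local_height_ge R Np hi; rewrite (prednK b0).
move=> hloc; apply: le_trans (_ : b%:R * ln (place_norm p)%:R / (\dim {:K})%:R <= _); last first.
  by rewrite ler_pM2r // invr_gt0 ltr0n adim_gt0.
have dle : delta ^+ n <= (D ^ k.+1)%:R.
  rewrite natrX; apply: le_trans (_ : (delta ^+ m) ^+ k.+1 <= _).
    by rewrite -exprM -ns ler_weXn2l ?leq_addr // ltW.
  apply: lerXn2r; rewrite ?nnegrE ?ler0n ?exprn_ge0 //; exact: ltW.
apply: le_trans (_ : cst * (b * d ^ m)%:R <= _).
  by rewrite ler_pM2l // (le_trans dle) // ler_nat.
rewrite /cst natrM le_eqVlt; apply/orP; left; apply/eqP; field.
by rewrite !pnatr_eq0 -!lt0n adim_gt0 expn_gt0.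
Qed.
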